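(* Let $X$ be a real vector space and $\mathcal F\subset\mathbb R^X$ a pointwise bounded family of sublinear functionals. A linear functional $\varphi$ on $X$ satisfies the condition $$\varphi(x)\le\sup_{f\in\mathcal F}f(x)\qquad\text{for all }x\in X$$ if and only if it may be represented in the form $$\varphi(x)=\int T(x,f)\,\lambda(df)\qquad\text{for all }x\in X$$ for a real-valued function $T$ on $X\times\overline{\mathcal F}^X$, in which (a) $\lambda$ is a Radon probability on $\mathscr B_X(\overline{\mathcal F}^X)$; (b) $T(x,\cdot)$ is $\mathscr B_X(\overline{\mathcal F}^X)$-measurable for each $x\in X$; (c) for each $x,y,z\in X$ and $a,b\in\mathbb R$ there exists a $\lambda$-null set $N(a,b;y,z)\in\mathscr B_X(\overline{\mathcal F}^X)$ such that $$T(x,f)\le f(x)\quad\text{and}\quad T(ay+bz,f)=aT(y,f)+bT(z,f)\qquad\text{for all }f\notin N(a,b;y,z).\qquad( * )$$ Moreover, if $X$ is a separable topological vector space, $\mathcal F$ is $X$-closed and $\varphi$ and each $f\in\mathcal F$ are continuous, then one may choose $T$ such that $( * )$ holds (for all $x,y,z\in X$ and $a,b\in\mathbb R$) for all $f$ outside some fixed $\lambda$-null set and, if $X$ is an $F$-space, even for all $f\in\mathcal F$.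
   Context: $\mathbb R^X$ is the set of all real-valued functions on $X$. The $X$-topology on $\mathbb R^X$ is the topology of pointwise convergence; the prefix ''$X$-'' refers to it. $\overline{\mathcal F}^X$ is the closure of $\mathcal F$ in $\mathbb R^X$ for the $X$-topology, and for $\mathcal H\subset\mathbb R^X$, $\mathscr B_X(\mathcal H)$ is the $\sigma$-algebra generated by the $X$-open (relatively open) subsets of $\mathcal H$. A sublinear functional is a subadditive, positively homogeneous function $X\to\mathbb R$. $\mathcal F$ is pointwise bounded if $\sup_{f\in\mathcal F}|f(x)|<\infty$ for every $x\in X$. An $F$-space is a topological vector space whose topology is induced by a complete translation-invariant metric. Families and sets are non-empty. *)

(* Defs.v *)
From HB Require Import structures.
From mathcomp Require Import all_boot all_order all_algebra.
From mathcomp Require Import all_classical all_reals all_analysis.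

Set Implicit Arguments.
Unset Strict Implicit.
Unset Printing Implicit Defensive.

Import Order.TTheory GRing.Theory Num.Theory.
Import numFieldNormedType.Exports.

Local Open Scope classical_set_scope.
Local Open Scope ring_scope.

Section families.
Context (R : realType) (X : lmodType R).

Definition sublinear (p : X -> R) : Prop :=
  (forall x y, p (x + y) <= p x + p y) /\
  (forall (a : R) x, 0 < a -> p (a *: x) = a * p x).

Definition ptws_bounded (F : set (X -> R)) : Prop :=
  forall x, exists M : R, forall f, F f -> `|f x| <= M.

(* The closure of F for the topology of pointwise convergence, as a subspace
   of {ptws X -> R}. The proof F0 is a parameter only because measurable types
   must be pointed. *)
Definition ptws_closure (F : set (X -> R)) (F0 : F !=set0) : Type :=
  set_type (closure (F : set {ptws X -> R})).

HB.instance Definition _ (F : set (X -> R)) (F0 : F !=set0) :=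
  Topological.on (ptws_closure F0).

Lemma ptws_closure_neq0 (F : set (X -> R)) (F0 : F !=set0) :
  exists _ : ptws_closure F0, True.
Proof.
have [f Ff] := F0.
have cf : (f : {ptws X -> R}) \in closure (F : set {ptws X -> R}).
  by rewrite inE; exact: (@subset_closure {ptws X -> R} F f Ff).
by exists (exist (fun g => g \in closure (F : set {ptws X -> R})) f cf).
Qed.

HB.instance Definition _ (F : set (X -> R)) (F0 : F !=set0) :=
  isPointed.Build (ptws_closure F0) (projT1 (cid (ptws_closure_neq0 F0))).

End families.

Definition borel_type (T : ptopologicalType) : measurableType _ :=
  g_sigma_algebraType (@open T).

(* Finiteness on compact sets is automatic for a probability. The space is
   meant to be Hausdorff, so that compact sets are Borel. *)
Definition radon (R : realType) (T : ptopologicalType)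
    (mu : probability (borel_type T) R) : Prop :=
  forall B : set (borel_type T), measurable B ->
    mu B = ereal_sup [set mu K | K in [set K : set T | compact K /\ K `<=` B]].

Section representation.
Context (R : realType) (X : lmodType R) (F : set (X -> R)) (F0 : F !=set0).

Notation Fbar := (borel_type (ptws_closure F0)).

Definition fun_of (f : ptws_closure F0) : X -> R := set_val f.

(* The integral is extended-real valued, with +oo - +oo = -oo. As T x is
   measurable, its equality with a real number entails integrability. *)
Definition represents (phi : X -> R) (lambda : probability Fbar R)
    (T : X -> ptws_closure F0 -> R) : Prop :=
  [/\ radon lambda,
      forall x, measurable_fun [set: Fbar] (T x : Fbar -> R) &
      forall x, (phi x)%:E = (\int[lambda]_(f in [set: Fbar]) (T x f)%:E)%E ].

Definition dominated_linear (T : X -> ptws_closure F0 -> R)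
    (a b : R) (x y z : X) (f : ptws_closure F0) : Prop :=
  T x f <= fun_of f x /\ T (a *: y + b *: z) f = a * T y f + b * T z f.

Definition borel_null (lambda : probability Fbar R) (N : set Fbar) : Prop :=
  measurable N /\ lambda N = 0%E.

End representation.

Section topological.
Context (R : realType) (X : topologicalLmodType R).

Definition separable : Prop := exists D : set X, countable D /\ dense D.

Definition F_space : Prop :=
  exists d : X -> X -> R,
    [/\ forall x y, d x y = 0 <-> x = y,
        forall x y, d x y = d y x &
        forall x y z, d x z <= d x y + d y z] /\
    [/\ forall x y z, d (x + z) (y + z) = d x y,
        forall (x : X) (A : set X),
          nbhs x A <-> exists2 e : R, 0 < e & [set y | d x y < e] `<=` A &
        forall u : nat -> X,
          (forall e : R, 0 < e -> exists N, forall m n,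
            (N <= m)%N -> (N <= n)%N -> d (u m) (u n) < e) ->
          exists l : X, u @ \oo --> l].

End topological.

(* Main.v *)
(** A Hahn-Banach extension applied to [h |-> sup h] on the bounded functions on
    the compact space [K], the pointwise closure of [F], and to the evaluations
    [x |-> (f |-> f x)] yields a finitely additive probability on [K] under
    which every evaluation at [x] has mean at least [phi x]; regularizing it
    gives a Radon probability [lambda] with the same property.  A second
    Hahn-Banach extension, of [phi] from the constant functions to the [X]-valued
    step functions [u] on [K], dominated by [\int f (u f) dlambda], assigns to
    each [x] a set function [A |-> Phi (1_A x)] dominated by a multiple of
    [lambda]; its Radon-Nikodym density is [T x].

    If [X] is separable and each [f] is continuous, [T] is redefined off a null
    set as [inf_n (T (y n) f + f (x - y n))], for a dense countable subgroup [y].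
    On that null set, the countable iteration of one-step Hahn-Banach
    infima along [y] chooses a linear minorant of [f] measurably in [f]. *)

Require Import Defs.
From HB Require Import structures.
From mathcomp Require Import all_boot all_order all_algebra.
From mathcomp Require Import all_classical all_reals all_analysis.
From mathcomp Require Import measurable_realfun.
From mathcomp Require Import ring lra.

Set Implicit Arguments.
Unset Strict Implicit.
Unset Printing Implicit Defensive.

Import Order.TTheory GRing.Theory Num.Theory.
Import numFieldNormedType.Exports.

Local Open Scope classical_set_scope.
Local Open Scope ring_scope.

(** * Sublinear functionals and the Hahn-Banach theorem *)

Section inf_family.
Context {R : realType} {I : Type}.
Implicit Type f : I -> R.

Lemma inf_range_le f c i : (forall j, c <= f j) -> inf (range f) <= f i.
Proof.
by move=> cf; apply: ge_inf; [exists c => _ [j _ <-] | exists i].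
Qed.

Lemma le_inf_range f c (i : I) : (forall j, c <= f j) -> c <= inf (range f).
Proof.
by move=> cf; apply: lb_le_inf; [exists (f i), i | move=> _ [j _ <-]].
Qed.

End inf_family.

Lemma le_inf_rangeD {R : realType} {I J : Type} (f : I -> R) (g : J -> R) c
    (i : I) (j : J) :
  (forall i j, c <= f i + g j) -> c <= inf (range f) + inf (range g).
Proof.
move=> cfg; rewrite -lerBlDl; apply: (le_inf_range j) => k.
rewrite lerBlDl -lerBlDr; apply: (le_inf_range i) => l.
by rewrite lerBlDr.
Qed.


Lemma sup_range_ge {R : realType} {I : Type} (f : I -> R) c i :
  (forall j, f j <= c) -> f i <= sup (range f).
Proof.
by move=> cf; apply: ub_le_sup; [exists c => _ [j _ <-] | exists i].
Qed.

Lemma sup_range_le {R : realType} {I : Type} (f : I -> R) c (i : I) :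
  (forall j, f j <= c) -> sup (range f) <= c.
Proof.
by move=> cf; apply: ge_sup; [exists (f i), i | move=> _ [j _ <-]].
Qed.

(* Homogeneity is required for natural multiples only: such functionals are
   preserved by the countable infimum [lower] below. *)
Definition nat_sublinear {R : realType} {V : zmodType} (p : V -> R) : Prop :=
  (forall x y, p (x + y) <= p x + p y) /\ (forall x n, p (x *+ n) = p x *+ n).

Section nat_sublinear.
Context {R : realType} {V : zmodType}.
Implicit Types (p : V -> R) (x : V).

Lemma nat_sublinear0 p : nat_sublinear p -> p 0 = 0.
Proof. by move=> [_ /(_ 0 0%N)]; rewrite !mulr0n. Qed.

Lemma nat_sublinear_opp p x : nat_sublinear p -> - p (- x) <= p x.
Proof.
by move=> ps; have [/(_ x (- x)) + _] := ps; rewrite subrr nat_sublinear0//; lra.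
Qed.

(* The sequence is nonincreasing in [n]; this is why the infimum is homogeneous. *)
Definition lower p x y : R := inf (range (fun n => p (y + x *+ n) - p x *+ n)).

Section lower.
Variables (p : V -> R) (x : V).
Hypothesis ps : nat_sublinear p.

(** Subadditivity for [x *+ n = (y + x *+ n) - y]. The bound does not depend on [n], so the infimum
    in [lower] is over a set bounded below. *)
Lemma lower_lbound y n : - p (- y) <= p (y + x *+ n) - p x *+ n.
Proof.
have [pD pn] := ps; have := pD (y + x *+ n) (- y).
by rewrite addrAC subrr add0r pn; lra.
Qed.

Lemma lower_range y n : lower p x y <= p (y + x *+ n) - p x *+ n.
Proof. exact: inf_range_le (lower_lbound y). Qed.

Lemma lower_le y : lower p x y <= p y.
Proof. by apply: le_trans (lower_range y 0) _; rewrite !mulr0n addr0 subr0. Qed.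

Lemma lower_ge y : - p (- y) <= lower p x y.
Proof. exact: le_inf_range 0%N (lower_lbound y). Qed.

(** The term [n = 1] of the infimum. Passing from [p] to [lower p x] thus forces oddness at [x]; if
    [p] cannot be lowered, then [p (- x) <= - p x]. *)
Lemma lower_opp : lower p x (- x) <= - p x.
Proof.
apply: le_trans (lower_range _ 1) _.
by rewrite !mulr1n addNr (nat_sublinear0 ps) sub0r.
Qed.

Lemma lower_nat_sublinear : nat_sublinear (lower p x).
Proof.
have [pD pn] := ps; split=> [y z|y [|n]].
- apply: (@le_inf_rangeD _ _ _ _ _ _ 0%N 0%N) => i j.
  apply: le_trans (lower_range _ (i + j)) _.
  rewrite !mulrnDr addrACA; have := pD (y + x *+ i) (z + x *+ j); lra.
- rewrite !mulr0n; apply/eqP; rewrite eq_le.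
  have p0 := nat_sublinear0 ps.
  by rewrite -{1}p0 lower_le -oppr0 -p0 -[X in p X]oppr0 lower_ge.
apply/eqP; rewrite eq_le; apply/andP; split.
- rewrite -[leRHS]mulr_natl -ler_pdivrMl ?ltr0n//.
  apply: (le_inf_range 0%N) => i; rewrite ler_pdivrMl ?ltr0n// mulr_natl.
  apply: le_trans (lower_range _ (i * n.+1)) _.
  by rewrite !mulrnA -mulrnDl pn -mulrnBl.
(* At the point [y *+ n.+1], the term of index [i * n.+1] is at most the term of index [i], and the
   former is an exact multiple of the term of index [i] at [y]. *)
- apply: (le_inf_range 0%N) => i.
  apply: (@le_trans _ _ ((p (y + x *+ i) - p x *+ i) *+ n.+1)).
    by rewrite lerMn2r lower_range orbT.
  rewrite mulrnBl -(pn (y + _)) mulrnDl -!mulrnA.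
  have -> : (i * n.+1 = i + i * n)%N by rewrite mulnS.
  rewrite !mulrnDr addrA; have := pD (y *+ n.+1 + x *+ i) (x *+ (i * n)).
  rewrite pn; lra.
Qed.

End lower.
End nat_sublinear.

Lemma sublinear_nat_sublinear {R : realType} {V : lmodType R} (p : V -> R) :
  sublinear p -> nat_sublinear p.
Proof.
move=> [pD pZ]; split=> // x [|n]; last first.
  by rewrite -scaler_nat pZ ?ltr0n// mulr_natl.
have /eqP := pZ 2 0 ltac:(lra); rewrite scaler0 !mulr0n => /eqP; lra.
Qed.

Section additive_dominated.
Context {R : realType} {V : lmodType R} (p f : V -> R).
Hypotheses (pD : forall x y, p (x + y) <= p x + p y)
           (pN : forall x, p x + p (- x) <= 0)
           (fs : sublinear f) (pf : forall x, p x <= f x).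

Let p0 : p 0 = 0.
Proof. by have := pD 0 0; have := pN 0; rewrite oppr0 addr0; lra. Qed.

Let pNE x : p (- x) = - p x.
Proof. by have := pD x (- x); have := pN x; rewrite subrr p0; lra. Qed.

Let pDE x y : p (x + y) = p x + p y.
Proof. by have := pD x y; have := pD (x + y) (- y); rewrite addrK pNE; lra. Qed.

Let pMn x n : p (x *+ n) = p x *+ n.
Proof. by elim: n => [|n ih]; rewrite ?mulr0n// !mulrS pDE ih. Qed.

Let pMz x (n : int) : p (n%:~R *: x) = n%:~R * p x.
Proof.
have H m : p (m%:R *: x) = m%:R * p x by rewrite scaler_nat pMn mulr_natl.
case: n => n; first by rewrite -pmulrn H.
by rewrite NegzE mulrNz -pmulrn scaleNr pNE H mulNr.
Qed.

(* [a |-> p (a x) - a p x] is additive, vanishes on integers, and is bounded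
   above on the unit interval, hence everywhere. *)
Let pZ_le a x : p (a *: x) <= a * p x.
Proof.
rewrite leNgt; apply/negP => apx.
pose e := p (a *: x) - a * p x; have e0 : 0 < e by rewrite /e; lra.
pose C := `|f x| + `|p x|.
(* The excess [e] at [a] becomes [e *+ n] at [n%:R * a], where it equals the excess at the
   fractional part [d]. A bound uniform in [n] contradicts [0 < e]. *)
suff eC n : e *+ n <= C.
  have := truncnS_gt (C / e); rewrite ltr_pdivrMr// mulr_natl.
  by move=> /lt_le_trans /(_ (eC _)); rewrite ltxx.
pose m := Num.floor (n%:R * a); pose d := n%:R * a - m%:~R.
have d0 : 0 <= d by rewrite /d subr_ge0 floor_le.
have d1 : d <= 1 by have := floorD1_gt (n%:R * a); rewrite /d intrD -/m; lra.
have -> : e *+ n = p (d *: x) - d * p x.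
  rewrite /d scalerBl -[p (_ - _)]/(p (_ + _)) pDE pNE pMz -scalerA scaler_nat pMn /e -mulr_natl; ring.
have pd : p (d *: x) <= d * f x.
  have [->|dn0] := eqVneq d 0; first by rewrite scale0r mul0r p0.
  by rewrite -(fs.2 _ _ _) ?pf// lt_neqAle eq_sym dn0.
rewrite /C; have := ler_norm (f x); have := ler_norm (- p x); rewrite normrN.
have := normr_ge0 (f x); have := normr_ge0 (p x); nra.
Qed.

(** Subadditivity and [pN] make [p] odd and additive; [pZ_le] for [a] and for [- a] then gives
    homogeneity. *)
Lemma additive_dominated_linear a x y : p (a *: x + y) = a * p x + p y.
Proof.
rewrite pDE; congr (_ + _); apply/eqP; rewrite eq_le pZ_le /=.
by have := pZ_le (- a) x; rewrite scaleNr pNE; lra.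
Qed.

End additive_dominated.

Section hahn_banach.
Context {R : realType} {V : lmodType R} (q : V -> R).
Hypothesis qs : sublinear q.

Definition minorant : Type := {p : V -> R | nat_sublinear p /\ forall x, p x <= q x}.

(** The order is reversed so that the maximal element supplied by Zorn's lemma is a minimal
    minorant. *)
Let ge_minorant (p p' : minorant) : bool := `[< forall x, sval p' x <= sval p x >].

(** The pointwise infimum of a chain is finite because every minorant is at least [- q (- x)] at
    [x], and subadditive because two members of a chain always have one below both. *)
Let minorant_inf (A : set minorant) (p0 : minorant) : A p0 ->
  total_on A ge_minorant -> exists t, forall s, A s -> ge_minorant s t.
Proof.
move=> Ap0 Atot.
pose B := {s : minorant | A s}; pose b0 : B := exist _ p0 Ap0.
pose p x := inf (range (fun s : B => sval (sval s) x)).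
have lbp x (s : B) : - q (- x) <= sval (sval s) x.
  case: s => -[r [rs rq] Ar] /=; have := nat_sublinear_opp x rs.
  by have := rq (- x); lra.
have pB x (s : B) : p x <= sval (sval s) x := inf_range_le s (lbp x).
have comp (s t : B) : exists u : B, (forall x, sval (sval u) x <= sval (sval s) x) /\
    (forall x, sval (sval u) x <= sval (sval t) x).
  by have [/asboolP H|/asboolP H] := Atot _ _ (svalP s) (svalP t);
    [exists t | exists s].
have ps : nat_sublinear p.
  split=> [x y|x [|n]].
  - apply: (le_inf_rangeD b0 b0) => s t; have [u [us ut]] := comp s t.
    apply: le_trans (pB _ u) _; apply: le_trans ((svalP (sval u)).1.1 x y) _.
    exact: lerD.
  - rewrite !mulr0n; apply/eqP; rewrite eq_le.
    have s0 (s : B) : sval (sval s) 0 = 0 := nat_sublinear0 (svalP (sval s)).1.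
    by rewrite -[X in _ <= X](s0 b0) pB/= (le_inf_range b0)// => s; rewrite s0.
  - apply/eqP; rewrite eq_le; apply/andP; split.
      rewrite -[leRHS]mulr_natl -ler_pdivrMl ?ltr0n//.
      apply: (le_inf_range b0) => s; rewrite ler_pdivrMl ?ltr0n// mulr_natl.
      by rewrite -(svalP (sval s)).1.2 pB.
    apply: (le_inf_range b0) => s; rewrite (svalP (sval s)).1.2.
    by rewrite lerMn2r pB orbT.
have pq x : p x <= q x by apply: le_trans (pB x b0) _; exact: (svalP p0).2.
exists (exist _ p (conj ps pq)) => s As; apply/asboolP => x /=.
exact: (pB x (exist _ s As)).
Qed.

(* A minimal nat-sublinear minorant [p] of [q] equals each [lower p x], hence
   is odd and so linear. *)
Lemma hahn_banach : exists l : V -> R,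
  (forall a x y, l (a *: x + y) = a * l x + l y) /\ forall x, l x <= q x.
Proof.
pose t0 : minorant := exist _ q (conj (sublinear_nat_sublinear qs) (fun x => lexx _)).
have [||A Atot|[p [ps pq]] pmin] := @ZL_preorder minorant t0 ge_minorant.
- by move=> t; apply/asboolP => x.
- move=> r s t /asboolP sr /asboolP ts; apply/asboolP => x.
  exact: le_trans (ts x) (sr x).
- have [->|/set0P[p0 Ap0]] := eqVneq A set0; first by exists t0.
  exact: minorant_inf Ap0 Atot.
exists p; split=> //; apply: (additive_dominated_linear ps.1 _ qs pq) => x.
have lq y : lower p x y <= q y by apply: le_trans (lower_le _ ps _) (pq _).
have /pmin/asboolP/(_ (- x))/= : ge_minorant (exist _ p (conj ps pq))
    (exist _ (lower p x) (conj (lower_nat_sublinear x ps) lq)).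
  by apply/asboolP => y /=; exact: lower_le.
by have := lower_opp x ps; lra.
Qed.

End hahn_banach.

Section hahn_banach_submodule.
Context {R : realType} {V : lmodType R} (D : set V).
Hypotheses (D0 : D 0) (DL : forall a x y, D x -> D y -> D (a *: x + y)).

Let subD : {pred V} := fun x => `[< D x >].

Let subD_closed : submod_closed subD.
Proof.
split; first exact/asboolP.
by move=> a x y /asboolP Dx /asboolP Dy; apply/asboolP; exact: DL.
Qed.

HB.instance Definition _ := GRing.isSubmodClosed.Build R V subD subD_closed.

Let W : Type := {x : V | x \in subD}.
HB.instance Definition _ := SubType.on W.
HB.instance Definition _ := Choice.on W.
HB.instance Definition _ := [SubChoice_isSubLmodule of W by <:].

(** The theorem is applied to [D] as a module in its own right, and the result is extended by [0].
    This covers functionals such as suprema and integrals, which are sublinear only on bounded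
    functions or on step functions. *)
Lemma hahn_banach_on (q : V -> R) :
  (forall x y, D x -> D y -> q (x + y) <= q x + q y) ->
  (forall a x, D x -> 0 < a -> q (a *: x) = a * q x) ->
  exists l : V -> R,
    (forall a x y, D x -> D y -> l (a *: x + y) = a * l x + l y) /\
    forall x, D x -> l x <= q x.
Proof.
move=> qD qZ.
have Dv (w : W) : D (val w) by apply/asboolP; exact: (valP w).
have [|l [lL lq]] := @hahn_banach R W (q \o val).
  split=> [x y|a x a0]; first rewrite /comp raddfD.
  exact: qD (Dv x) (Dv y).
  by rewrite /comp linearZ; exact: qZ (Dv x) a0.
pose L x := if pselect (D x) is left Dx then l (Sub x (asboolT Dx)) else 0.
have LE x (Dx : D x) : L x = l (Sub x (asboolT Dx)).
  by rewrite /L; case: pselect => // Dx'; congr l; exact: val_inj.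
exists L; split=> [a x y Dx Dy|x Dx]; last by rewrite LE (le_trans (lq _)).
rewrite !LE; first exact: DL.
by move=> Dz; rewrite -lL; congr l; apply: val_inj.
Qed.

(* The sublinear functional [v |-> inf_x (q (v + J x) - phi x)] is dominated by
   [q], and its linear minorants [l] satisfy [phi x <= l (J x)]. *)
Lemma hahn_banach_extension (X : lmodType R) (q : V -> R) (J : X -> V)
    (phi : {scalar X}) :
  (forall x y, D x -> D y -> q (x + y) <= q x + q y) ->
  (forall a x, D x -> 0 < a -> q (a *: x) = a * q x) ->
  (forall x, D (J x)) ->
  (forall v x y, D v -> q (v + J (x + y)) <= q (v + (J x + J y))) ->
  (forall a x, 0 < a -> J (a *: x) = a *: J x) ->
  (forall x, phi x <= q (J x)) ->
  exists l : V -> R,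
    [/\ forall a x y, D x -> D y -> l (a *: x + y) = a * l x + l y,
        forall v, D v -> l v <= q v & forall x, phi x <= l (J x)].
Proof.
move=> qD qZ DJ qJ JZ phiq.
have DD x y : D x -> D y -> D (x + y) by move=> *; rewrite -[x]scale1r; exact: DL.
have DZ a x : D x -> D (a *: x) by move=> *; rewrite -[_ *: _]addr0; exact: DL.
have DN x : D x -> D (- x) by move=> *; rewrite -scaleN1r; exact: DZ.
have q0 : q 0 = 0 by have := @qZ 2 0 D0 ltac:(lra); rewrite scaler0; lra.
have J0 : J 0 = 0.
  have /eqP := @JZ 2 0 ltac:(lra).
  by rewrite scaler0 scaler_nat mulr2n -subr_eq0 opprD addrA subrr add0r oppr_eq0 => /eqP.
pose P v := inf (range (fun x => q (v + J x) - phi x)).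
have lbP v x : D v -> - q (- v) <= q (v + J x) - phi x.
  move=> Dv; have := qD (v + J x) (- v) (DD _ _ Dv (DJ x)) (DN _ Dv).
  by rewrite addrAC subrr add0r; have := phiq x; lra.
have Ple v x : D v -> P v <= q (v + J x) - phi x.
  by move=> Dv; apply: inf_range_le => y; exact: lbP.
have [x y Dx Dy|a x Dx a0|l [lL lP]] := @hahn_banach_on P.
(* The index [z + w] serves the pair [z], [w]; [qJ] makes up for [J] not being additive. *)
- apply: (le_inf_rangeD 0 0) => z w; apply: le_trans (Ple _ (z + w) (DD _ _ Dx Dy)) _.
  have := qJ (x + y) z w (DD _ _ Dx Dy).
  rewrite addrACA => /le_trans /(_ (qD _ _ (DD _ _ Dx (DJ z)) (DD _ _ Dy (DJ w)))).
  by rewrite raddfD/=; lra.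
- have PZ b y : D y -> 0 < b -> P (b *: y) <= b * P y.
    move=> Dy b0; rewrite -ler_pdivrMl//; apply: (le_inf_range 0) => z.
    rewrite ler_pdivrMl//; apply: le_trans (Ple _ (b *: z) (DZ _ _ Dy)) _.
    have phiZ : phi (b *: z) = b * phi z by rewrite linearZ.
    by rewrite JZ// -scalerDr (qZ _ _ (DD _ _ Dy (DJ z)) b0) phiZ mulrBr.
  apply/eqP; rewrite eq_le PZ//= -ler_pdivlMl//.
  have := PZ a^-1 _ (DZ a _ Dx); rewrite invr_gt0 => /(_ a0).
  by rewrite scalerA mulVf ?gt_eqF// scale1r.
have lq v : D v -> l v <= q v.
  move=> Dv; apply: le_trans (lP v Dv) _.
  by apply: le_trans (Ple v 0 Dv) _; rewrite J0 addr0 raddf0 subr0.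
exists l; split=> // x.
have l0 : l 0 = 0 by have := lL 1 0 0 D0 D0; rewrite scale1r addr0; lra.
(* The term of index [x] in [P (- J x)] is [q 0 - phi x], whence [- l (J x) <= - phi x]. *)
have := lP _ (DN _ (DJ x)); have := Ple _ x (DN _ (DJ x)); rewrite addNr q0.
by have := lL (-1) (J x) 0 (DJ x) D0; rewrite scaleN1r addr0 l0; lra.
Qed.

End hahn_banach_submodule.

(** * Radon probabilities from finitely additive ones *)

Section radon_of_content.
Context {R : realType} {T : ptopologicalType} (m : set T -> R).
Hypotheses (cT : compact [set: T]) (hT : hausdorff_space T).
Hypotheses (m_ge0 : forall A, 0 <= m A) (mT : m setT = 1)
  (mU : forall A B, A `&` B = set0 -> m (A `|` B) = m A + m B).

Let m0 : m set0 = 0.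
Proof. by have := mU (setI0 set0); rewrite setU0; lra. Qed.

Let le_m A B : A `<=` B -> m A <= m B.
Proof.
move=> AB; have := @mU A (B `\` A) (setDIK _ _); rewrite setDUK//.
by have := m_ge0 (B `\` A); lra.
Qed.

Let mU_le A B : m (A `|` B) <= m A + m B.
Proof.
have AB : A `|` (B `\` A) = A `|` B.
  by apply/seteqP; split=> x /=; [tauto|have := pselect (A x); tauto].
by rewrite -AB (mU (setDIK _ _)) lerD2l; apply: le_m => x [].
Qed.

Let mC A : m (~` A) = 1 - m A.
Proof. by have := mU (setICr A); rewrite setUCr mT; lra. Qed.

(* [m] need be neither countably additive nor regular: open sets are measured
   from inside by closed sets, and all others from outside by open sets. *)
Let inner (U : set T) : R := sup [set m C | C in [set C | closed C /\ C `<=` U]].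

Let inner_ge C U : closed C -> C `<=` U -> m C <= inner U.
Proof.
move=> cC CU; apply: ub_le_sup; last by exists C.
by exists 1 => _ [D _ <-]; rewrite -mT; exact: le_m.
Qed.

Let inner_le U c : (forall C, closed C -> C `<=` U -> m C <= c) -> inner U <= c.
Proof.
move=> H; apply: ge_sup; last by move=> _ [C [cC CU] <-]; exact: H.
by exists (m set0), set0; split=> //; exact: closed0.
Qed.

Let inner_ge0 U : 0 <= inner U.
Proof. by rewrite -m0 inner_ge//; exact: closed0. Qed.

Let inner_m U : inner U <= m U.
Proof. by apply: inner_le => C _; exact: le_m. Qed.

Let le_inner U V : U `<=` V -> inner U <= inner V.
Proof.
by move=> UV; apply: inner_le => C cC CU; apply: inner_ge => //; exact: subset_trans UV.
Qed.

(** By normality, a closed [C] inside the union splits into two closed pieces: an open [W'] around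
    [C] minus [U] has its closure inside [V], so [C] minus [W'] lies in [U] and the rest of [C] lies
    in [V]. *)
Let innerU U V : open U -> open V -> inner (U `|` V) <= inner U + inner V.
Proof.
move=> oU oV; apply: inner_le => C cC CUV.
have cCU : closed (C `\` U) by apply: closedI => //; exact: open_closedC.
have VCU : set_nbhs (C `\` U) V.
  by apply/set_nbhsP; exists V; split=> // x [/CUV[]].
have [W /set_nbhsP[W' [oW' CW' W'W]] WV] := compact_normal hT cT cCU VCU.
apply: (@le_trans _ _ (m (C `\` W') + m (C `&` closure W))).
  apply: le_trans (mU_le _ _); apply: le_m => x Cx.
  have [W'x|W'x] := pselect (W' x); last by left.
  by right; split=> //; exact/subset_closure/W'W.
apply: lerD; apply: inner_ge.
- by apply: closedI => //; exact: open_closedC.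
- by move=> x [Cx W'x]; apply: contrapT => Ux; exact/W'x/CW'.
- by apply: closedI => //; exact: closed_closure.
- by move=> x [_ /WV].
Qed.

Let inner_bigU (U : nat -> set T) n : (forall i, open (U i)) ->
  inner (\big[setU/set0]_(i < n) U i) <= \sum_(i < n) inner (U i).
Proof.
move=> oU; elim: n => [|n ih]; first by rewrite !big_ord0 -m0 inner_m.
rewrite !big_ord_recr/=; apply: le_trans (lerD ih (lexx _)).
by apply: innerU => //; elim/big_ind: _ => //; [exact: open0|exact: openU].
Qed.

(** Compactness replaces countable additivity of [m]: a closed set inside the union is covered by
    finitely many [U i], to which [inner_bigU] applies. *)
Let inner_bigcup (U : nat -> set T) : (forall i, open (U i)) ->
  ((inner (\bigcup_i U i))%:E <= \sum_(i <oo) (inner (U i))%:E)%E.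
Proof.
move=> oU.
have H C : closed C -> C `<=` \bigcup_i U i ->
    ((m C)%:E <= \sum_(i <oo) (inner (U i))%:E)%E.
  move=> cC CU; have cptC : compact C := subclosed_compact cC cT (@subsetT _ _).
  rewrite compact_cover in cptC.
  have [D _ CD] := cptC _ setT U (fun i _ => oU i) CU.
  pose n := (\max_(i <- finmap.enum_fset D) i).+1.
  apply: (@le_trans _ _ (\sum_(i < n) inner (U i))%:E).
    rewrite lee_fin; apply: le_trans (inner_bigU n oU); apply: inner_ge => // x Cx.
    have [i Di Ux] := CD _ Cx; rewrite -bigcup_mkord; exists i => //=.
    by rewrite ltnS; apply: leq_bigmax_seq.
  rewrite -sumEFin -(big_mkord xpredT (fun i => (inner (U i))%:E)).
  by apply: nneseries_lim_ge => i _ _; rewrite lee_fin.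
case: (\sum_(i <oo) _)%E H => [r| |] H; [|by rewrite leey|].
  by rewrite lee_fin; apply: inner_le => C cC CU; rewrite -lee_fin H.
by have := H set0 closed0 (@sub0set _ _); rewrite leeNy_eq.
Qed.

Let outer (A : set T) : R := inf [set inner U | U in [set U | open U /\ A `<=` U]].

Let outer_le A U : open U -> A `<=` U -> outer A <= inner U.
Proof.
by move=> oU AU; apply: ge_inf; [exists 0 => _ [V _ <-] | exists U].
Qed.

Let outer_ge A c : (forall U, open U -> A `<=` U -> c <= inner U) -> c <= outer A.
Proof.
move=> H; apply: lb_le_inf; last by move=> _ [U [oU AU] <-]; exact: H.
by exists (inner setT), setT; split=> //; exact: openT.
Qed.

Let outer_approx A e : 0 < e -> exists U, [/\ open U, A `<=` U & inner U < outer A + e].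
Proof.
move=> e0; apply: contrapT => H.
suff : outer A + e <= outer A by lra.
apply: outer_ge => U oU AU; rewrite leNgt; apply/negP => Ue.
by apply: H; exists U.
Qed.

Let outer_open U : open U -> outer U = inner U.
Proof.
move=> oU; apply/eqP; rewrite eq_le outer_le//=.
by apply: outer_ge => V _; exact: le_inner.
Qed.

Let outer_ge0 A : 0 <= outer A.
Proof. by apply: outer_ge => U _ _; exact: inner_ge0. Qed.

Let le_outer A B : A `<=` B -> outer A <= outer B.
Proof.
by move=> AB; apply: outer_ge => U oU BU; apply: outer_le => //; exact: subset_trans BU.
Qed.

Let mu (A : set T) : \bar R := (outer A)%:E.

Let mu0 : mu set0 = 0%E.
Proof.
rewrite /mu outer_open; last exact: open0.
by congr _%:E; have := inner_m set0; have := inner_ge0 set0; rewrite m0; lra.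
Qed.

Let mu_ge0 A : (0 <= mu A)%E. Proof. by rewrite lee_fin. Qed.

Let le_mu : {homo mu : A B / A `<=` B >-> (A <= B)%E}.
Proof. by move=> A B AB; rewrite lee_fin le_outer. Qed.

Let mu_sigma_subadditive : sigma_subadditive mu.
Proof.
move=> F; apply/lee_addgt0Pr => e e0.
have ei i : 0 < e / (2 ^ i.+1)%:R by rewrite divr_gt0// ltr0n expn_gt0.
have /choice[U HU] := fun i => outer_approx (F i) (ei i).
apply: (@le_trans _ _ (\sum_(i <oo) (mu (F i) + (e / (2 ^ i.+1)%:R)%:E))%E); last first.
  by apply: epsilon_trick => //; exact: ltW.
apply: (@le_trans _ _ (\sum_(i <oo) (inner (U i))%:E)%E); last first.
  apply: lee_nneseries => i _; first by rewrite lee_fin.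
  by rewrite lee_fin ltW//; have [] := HU i.
have oU i : open (U i) by have [] := HU i.
have oUU : open (\bigcup_i U i) by apply: bigcup_open.
apply: (@le_trans _ _ (inner (\bigcup_i U i))%:E).
  rewrite lee_fin; apply: outer_le => // x [i _ Fx].
  by exists i => //; have [_ + _] := HU i; apply.
exact: inner_bigcup.
Qed.

HB.instance Definition _ := isOuterMeasure.Build R T mu mu0 mu_ge0 le_mu mu_sigma_subadditive.

(** Let [V] be open and contain [X]. A closed [C] inside both [V] and [U] and a closed [D] inside
    [V] minus [C] are disjoint, so [m C + m D <= inner V]. Suprema over [D], then over [C], give the
    Caratheodory inequality. *)
Let open_caratheodory U : open U -> mu.-caratheodory U.
Proof.
move=> oU; apply: le_caratheodory_measurable => X.
rewrite -EFinD lee_fin; apply: outer_ge => V oV XV.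
have oVU : open (V `&` U) by exact: openI.
suff : inner (V `&` U) <= inner V - outer (X `&` ~` U).
  have : outer (X `&` U) <= inner (V `&` U); last by lra.
  by apply: outer_le => // x [/XV].
apply: inner_le => C cC CVU; have oVC : open (V `\` C) by apply: openI => //; exact: closed_openC.
suff : inner (V `\` C) <= inner V - m C.
  have : outer (X `&` ~` U) <= inner (V `\` C); last by lra.
  apply: outer_le => // x [/XV Vx Ux]; split=> // /CVU[_]; exact: Ux.
apply: inner_le => D cD DVC; rewrite lerBrDl -mU.
  apply: inner_ge; first exact: closedU.
  by move=> x [/CVU[]|/DVC[]].
by apply/seteqP; split=> // x [Cx /DVC[]].
Qed.

Let measurable_caratheodory (A : set (borel_type T)) :
  measurable A -> mu.-cara.-measurable A.
Proof.
suff : <<s @open T >> `<=` mu.-cara.-measurable by exact.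
apply: smallest_sub => [|U]; last exact: open_caratheodory.
split=> [|X mX|F mF]; first exact: measurable0.
- by rewrite setTD; exact: measurableC.
- exact: bigcupT_measurable.
Qed.

Let lambda (A : set (borel_type T)) : \bar R := mu A.

Let lambda0 : lambda set0 = 0%E. Proof. exact: mu0. Qed.

Let lambda_ge0 A : (0 <= lambda A)%E. Proof. exact: mu_ge0. Qed.

Let lambda_sigma_additive : semi_sigma_additive lambda.
Proof.
move=> F mF tF mUF; apply: (@caratheodory_measure_sigma_additive _ _ mu) => //.
- by move=> i; exact: measurable_caratheodory (mF i).
- exact: measurable_caratheodory.
Qed.

HB.instance Definition _ := isMeasure.Build _ (borel_type T) R lambda
  lambda0 lambda_ge0 lambda_sigma_additive.

Let lambdaT : lambda setT = 1%E.
Proof.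
rewrite /lambda /mu outer_open; last exact: openT.
by rewrite (_ : inner setT = 1)//; apply/eqP; rewrite eq_le -mT inner_m inner_ge//; exact: closedT.
Qed.

HB.instance Definition _ := Measure_isProbability.Build _ _ R lambda lambdaT.

Let lambdaC (A : set T) : measurable (A : set (borel_type T)) -> outer (~` A) = 1 - outer A.
Proof.
move=> mA; have := @probability_setC _ _ _ lambda A mA.
by rewrite /lambda /= /mu -EFinB => -[].
Qed.

(** For inner regularity, an open set that nearly attains the outer measure of the complement of [B]
    has a compact complement inside [B]. For closed [C], the open set [~] C[is measured from inside
    and so gets at most]m (~[C)]; hence [C] gets at least [m C]. *)
Lemma radon_of_content : exists2 P : probability (borel_type T) R,
  radon P & forall C, closed C -> ((m C)%:E <= P C)%E.
Proof.
have mo U : open U -> measurable (U : set (borel_type T)).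
  by move=> oU; apply: sub_sigma_algebra.
exists lambda => [B mB|C cC].
  apply/eqP; rewrite eq_le; apply/andP; split; last first.
    by apply: ge_ereal_sup => _ [K [_ KB] <-]; exact: le_mu.
  apply/lee_addgt0Pr => e e0; have [U [oU BU Ue]] := outer_approx (~` B) e0.
  have KB : ~` U `<=` B by move=> x Ux; apply: contrapT => /BU.
  have cK : closed (~` U) by exact: open_closedC.
  apply: (@le_trans _ _ (lambda (~` U) + e%:E)%E).
    rewrite /lambda /mu -EFinD lee_fin (lambdaC (mo _ oU)) (outer_open oU).
    by move: Ue; rewrite lambdaC//; lra.
  rewrite leeD2r//; apply: ereal_sup_ubound; exists (~` U) => //; split=> //.
  exact: subclosed_compact cK cT (@subsetT _ _).
have oC : open (~` C) := closed_openC cC.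
have := lambdaC (mo _ oC); rewrite setCK (outer_open oC) => E.
by rewrite lee_fin E; have := inner_m (~` C); rewrite mC; lra.
Qed.

End radon_of_content.

(** * Bounded functions and their integrals *)

Definition bounded_on {R : realType} {T : Type} (f : T -> R) : Prop :=
  exists M, forall t, `|f t| <= M.

Section bounded_on.
Context {R : realType} {T : Type}.
Implicit Types f g : T -> R.

Lemma bounded_on_lin a f g : bounded_on f -> bounded_on g ->
  bounded_on (fun t => a * f t + g t).
Proof.
move=> [M fM] [N gN]; exists (`|a| * M + N) => t.
by rewrite (le_trans (ler_normD _ _))// lerD// normrM ler_wpM2l.
Qed.

Lemma bounded_on_cst (c : R) : bounded_on (fun _ : T => c).
Proof. by exists `|c|. Qed.

Lemma bounded_on_indic (A : set T) : bounded_on (\1_A : T -> R).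
Proof. by exists 1 => t; rewrite indicE; case: (_ \in _); rewrite ?normr1 ?normr0. Qed.

Lemma bounded_on_sum n (F : 'I_n -> T -> R) : (forall i, bounded_on (F i)) ->
  bounded_on (fun t => \sum_(i < n) F i t).
Proof.
move=> /choice[M FM]; exists (\sum_i M i) => t.
by apply: le_trans (ler_norm_sum _ _ _) _; apply: ler_sum.
Qed.

End bounded_on.

Lemma bounded_on_integrable {R : realType} d (T : measurableType d)
    (P : probability T R) (f : T -> R) A : measurable A ->
  measurable_fun setT f -> bounded_on f -> P.-integrable A (EFin \o f).
Proof.
move=> mA mf [M fM]; apply: (integrableS measurableT) => //.
apply: measurable_bounded_integrable => //.
  by rewrite (le_lt_trans (probability_le1 _ _))// ltry.
exists M; split; rewrite ?num_real// => N MN t _ /=.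
by rewrite (le_trans (fM t))// ltW.
Qed.

Lemma Rintegral_sum {R : realType} d (T : measurableType d)
    (mu : {measure set T -> \bar R}) n (F : 'I_n -> T -> R) :
  (forall i, mu.-integrable setT (EFin \o F i)) ->
  Rintegral mu setT (fun t => \sum_(i < n) F i t) =
  \sum_(i < n) Rintegral mu setT (F i).
Proof.
elim: n F => [|n ih] F iF.
  rewrite big_ord0; under eq_Rintegral do rewrite big_ord0.
  by rewrite Rintegral_cst// mul0r.
rewrite big_ord_recr/= -ih// -RintegralD//.
  by apply: eq_Rintegral => t _; rewrite big_ord_recr.
rewrite (_ : _ \o _ = fun t => \sum_(i < n) (F (widen_ord (leqnSn n) i) t)%:E)%E.
  by apply: integrable_sum => // i _; exact: iF.
by apply/funext => t /=; rewrite sumEFin.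
Qed.

Lemma Rintegral_probability_cst {R : realType} d (T : measurableType d)
    (P : probability T R) c : Rintegral P setT (fun=> c) = c.
Proof. by rewrite Rintegral_cst//= probability_setT mulr1. Qed.

(** The sum rounds [g] down to a multiple of [e]. The invariant of the induction is that either all
    levels so far are reached or the sum is already within [e] of [g]; the bound on [g] settles the
    first case at [n]. *)
Lemma layer_cake {R : realType} (g e : R) (n : nat) : 0 <= g -> 0 < e ->
  g <= e *+ n ->
  \sum_(k < n) e * (e *+ k.+1 <= g)%R%:R <= g <= \sum_(k < n) e * (e *+ k.+1 <= g)%R%:R + e.
Proof.
move=> g0 e0 gn; set S := fun n => \sum_(k < n) e * (e *+ k.+1 <= g)%R%:R.
suff : forall m, [/\ S m <= g, S m <= e *+ m & S m = e *+ m \/ g < S m + e].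
  by move=> /(_ n); rewrite -/(S n) => -[-> _ [Sn|/ltW ->//]] /=; rewrite Sn; lra.
elim=> [|m [Sg Sm H]]; first by rewrite /S big_ord0 mulr0n; split=> //; left.
rewrite [S m.+1]big_ord_recr/= -/(S m).
have [mg|mg] := leP (e *+ m.+1) g; rewrite ?mulr1 ?mulr0 ?addr0 mulrSr.
  rewrite mulrSr in mg.
  have Sme : S m = e *+ m by case: H => //; lra.
  by rewrite Sme; split; [lra|lra|left].
rewrite mulrSr in mg.
by split; [lra|lra|right; case: H => [->|]; lra].
Qed.

Lemma continuous_borel_measurable {R : realType} {T : ptopologicalType} (h : T -> R) :
  continuous h -> measurable_fun [set: borel_type T] (h : borel_type T -> R).
Proof.
move=> ch; apply: (measurability _ (RGenOInfty.measurableE R)) => //.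
move=> _ [_ [x ->] <-]; rewrite setTI; apply: sub_sigma_algebra.
by apply: open_comp => [t _|]; [exact: ch|rewrite set_itvE; exact: open_gt].
Qed.

(** * Radon probabilities from linear functionals on bounded functions *)

Section radon_of_functional.
Context {R : realType} {T : ptopologicalType} (L : (T -> R) -> R).
Hypotheses (cT : compact [set: T]) (hT : hausdorff_space T).
Hypotheses (LL : forall a f g, bounded_on f -> bounded_on g ->
    L (fun t => a * f t + g t) = a * L f + L g)
  (L_le : forall f c, bounded_on f -> (forall t, f t <= c) -> L f <= c).

Let L0 : L (fun=> 0) = 0.
Proof.
have := @LL 1 _ _ (bounded_on_cst 0) (bounded_on_cst 0).
by under eq_fun do rewrite mulr0 addr0; lra.
Qed.

Let LZ a f : bounded_on f -> L (fun t => a * f t) = a * L f.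
Proof.
move=> bf; have := LL a bf (bounded_on_cst 0); rewrite L0 addr0 => <-.
by congr L; apply/funext => t; rewrite addr0.
Qed.

Let LD f g : bounded_on f -> bounded_on g -> L (fun t => f t + g t) = L f + L g.
Proof.
move=> bf bg; have := LL 1 bf bg; rewrite mul1r => <-.
by congr L; apply/funext => t; rewrite mul1r.
Qed.

(** [L_le] encodes both positivity and normalization: [c = 0] applied to [f - g] gives monotonicity,
    and [c] together with [- c] gives the value on constants. *)
Let L_mono f g : bounded_on f -> bounded_on g -> (forall t, f t <= g t) -> L f <= L g.
Proof.
move=> bf bg fg; have := LL (-1) bg bf.
have : L (fun t => -1 * g t + f t) <= 0.
  by apply: L_le => [|t]; [exact: bounded_on_lin|have := fg t; lra].
lra.
Qed.

Let Lc c : L (fun=> c) = c.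
Proof.
have H d : L (fun=> d) <= d by apply: L_le => //; exact: bounded_on_cst.
have := H c; have := H (- c); have := LZ (-1) (bounded_on_cst c).
by under eq_fun do rewrite mulN1r; lra.
Qed.

Let L_sum n (F : 'I_n -> T -> R) : (forall i, bounded_on (F i)) ->
  L (fun t => \sum_(i < n) F i t) = \sum_(i < n) L (F i).
Proof.
elim: n F => [|n ih] F bF.
  by rewrite big_ord0 -[RHS]L0; congr L; apply/funext => t; rewrite big_ord0.
rewrite big_ord_recr/= -ih// -LD//; last exact: bounded_on_sum.
by congr L; apply/funext => t; rewrite big_ord_recr.
Qed.

Let m (A : set T) := L (\1_A).

(** The superlevel sets of a continuous [h] are closed, and on closed sets [P] dominates the content
    [m]. Up to [e], the function [h + M] is a combination of indicators of such sets with positive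
    coefficients. *)
Lemma radon_of_functional : exists2 P : probability (borel_type T) R,
  radon P & forall h : T -> R, continuous h -> bounded_on h ->
    ((L h)%:E <= \int[P]_(t in [set: borel_type T]) (h t)%:E)%E.
Proof.
have [A|||P rP mP] := @radon_of_content R T m cT hT.
- rewrite /m -[0]Lc; apply: L_mono => [||t].
  + exact: bounded_on_cst.
  + exact: bounded_on_indic.
  + by rewrite indicE.
- by rewrite /m -(Lc 1); congr L; apply/funext => t; rewrite indicT.
- move=> A B AB; rewrite /m -LD; [|exact: bounded_on_indic..].
  congr L; apply/funext => t; rewrite !indicE in_setU.
  case: (boolP (t \in A)) => tA; last by rewrite add0r.
  case: (boolP (t \in B)) => tB; last by rewrite addr0.
  have : (A `&` B) t by split; exact: set_mem.
  by rewrite AB.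
exists P => // h ch bh.
have mh := continuous_borel_measurable ch.
have ih := bounded_on_integrable P measurableT mh bh.
rewrite -[leRHS]fineK; last exact: integrable_fin_num.
rewrite lee_fin -[fine _]/(Rintegral P setT h).
have [M hM] := bh.
apply/ler_addgt0Pr => e e0.
(* Enough levels of height [e] to reach [M + M], an upper bound of [h + M]. *)
pose n := (Num.truncn ((M + M) / e)).+1.
have Mn : M + M <= e *+ n.
  by rewrite -mulr_natl -ler_pdivrMr//; exact/ltW/truncnS_gt.
pose C k := [set t : T | e *+ k.+1 <= h t + M].
have cC k : closed (C k).
  rewrite (_ : C k = h @^-1` [set r | e *+ k.+1 - M <= r]).
    by apply: closed_comp => [t _|]; [exact: ch|exact: closed_ge].
  by apply/seteqP; split=> t /=; rewrite /C/= lerBlDr.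
have mc k : measurable (C k : set (borel_type T)).
  rewrite -[C k]setCK; apply: (@measurableC _ (borel_type T)).
  by apply: sub_sigma_algebra; exact: closed_openC.
pose s t := \sum_(k < n) e * \1_(C k) t.
have bI k : bounded_on (fun t => e * \1_(C k) t).
  have := bounded_on_lin e (bounded_on_indic (C k)) (bounded_on_cst 0).
  by under eq_fun do rewrite addr0.
have bs : bounded_on s by exact: bounded_on_sum.
have mI k : measurable_fun [set: borel_type T] (\1_(C k) : borel_type T -> R).
  exact: measurable_indic.
have ms : measurable_fun [set: borel_type T] (s : borel_type T -> R).
  by apply: measurable_sum => k; exact: measurable_funM.
have sh t : s t <= h t + M <= s t + e.
  have -> : s t = \sum_(k < n) e * (e *+ k.+1 <= h t + M)%R%:R.
    apply: eq_bigr => k _; rewrite indicE; congr (_ * (nat_of_bool _)%:R).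
    by apply/idP/idP; rewrite inE.
  by apply: layer_cake => //; have := hM t; rewrite ler_norml; lra.
have Lh : L h + M <= L s + e.
  have := LD bh (bounded_on_cst M); have := LD bs (bounded_on_cst e).
  rewrite !Lc => <- <-; apply: L_mono => [||t]; last by have /andP[] := sh t.
    by have := bounded_on_lin 1 bh (bounded_on_cst M); under eq_fun do rewrite mul1r.
  by have := bounded_on_lin 1 bs (bounded_on_cst e); under eq_fun do rewrite mul1r.
have iI k : P.-integrable setT (EFin \o (\1_(C k) : borel_type T -> R)).
  exact: bounded_on_integrable (mI k) (bounded_on_indic _).
have is_ : P.-integrable setT (EFin \o (s : borel_type T -> R)).
  exact: bounded_on_integrable ms bs.
have iM : P.-integrable setT (EFin \o (fun _ : borel_type T => M)).
  exact: bounded_on_integrable (bounded_on_cst M).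
have Ps : Rintegral P setT s <= Rintegral P setT h + M.
  have -> : M = Rintegral P setT (fun _ => M).
    by rewrite Rintegral_probability_cst.
  rewrite -RintegralD//; apply: le_Rintegral => // [|t _].
    by have := integrableD measurableT ih iM.
  by have /andP[] := sh t.
suff : L s <= Rintegral P setT s by lra.
have -> : L s = \sum_(k < n) e * m (C k).
  by rewrite /s L_sum//; apply: eq_bigr => k _; rewrite LZ//; exact: bounded_on_indic.
have -> : Rintegral P setT s = \sum_(k < n) e * fine (P (C k)).
  rewrite Rintegral_sum => [|k].
    apply: eq_bigr => k _; rewrite RintegralZl//; congr (_ * fine _).
    by rewrite integral_indic ?setIT.
  apply: (bounded_on_integrable P measurableT _ (bI k)).
  exact: measurable_funM.
apply: ler_sum => k _; rewrite ler_pM2l//.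
rewrite -lee_fin fineK; last exact: fin_num_measure.
exact: mP.
Qed.

End radon_of_functional.

(** * The pointwise closure *)

(** A cluster point in [A] of the image filter lifts to the subtype, whose open sets are traces of
    open sets of [T]. *)
Lemma compact_set_type {T : topologicalType} (A : set T) :
  compact A -> compact [set: set_type A].
Proof.
move=> cA G PG _.
have [|p [Ap Gp]] := cA (set_val @ G) _.
  by apply: (@filterS _ G _ setT) => [x _|]; [exact: set_valP|exact: filterT].
exists (exist _ p (mem_set Ap)); split=> // U V GU.
rewrite nbhsE; case=> B [[W oW <-] Wp] BV.
have [|_ [[x Ux <-] Wx]] := Gp (set_val @` U) W _ (open_nbhs_nbhs (conj oW Wp)).
  by apply: (@filterS _ G _ U) => [x Ux|//]; exists x.
by exists x; split=> //; exact: BV.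
Qed.

Lemma hausdorff_set_type {T : topologicalType} (A : set T) :
  hausdorff_space T -> hausdorff_space (set_type A).
Proof.
move=> hT p q pq.
suff : set_val p = set_val q.
  case: p q {pq} => p pA [q qA]; rewrite !set_valE /= => E.
  by move: pA qA; rewrite E => pA qA; congr exist; exact: bool_irrelevance.
apply: hT => U V pU qV.
have cv : continuous (set_val : set_type A -> T) := @initial_continuous _ _ _.
by have [z [Uz Vz]] := pq _ _ (cv _ _ pU) (cv _ _ qV); exists (set_val z).
Qed.

Section ptws_closure.
Context {R : realType} {X : lmodType R} {F : set (X -> R)} (F0 : F !=set0).
Hypothesis bF : ptws_bounded F.

Lemma fun_of_continuous x : continuous (fun f : ptws_closure F0 => fun_of f x).
Proof.
move=> f; apply: (@continuous_comp _ {ptws X -> R} _ set_val (fun g : X -> R => g x)).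
  exact: initial_continuous.
exact: (@proj_continuous _ (fun=> R) x).
Qed.

(** Transfers closed conditions from [F] to its closure: bounds at a point, sublinearity and, for
    closed [F], membership in [F] itself. *)
Lemma closure_closed_ptws (P : set {ptws X -> R}) (f : ptws_closure F0) :
  closed P -> F `<=` P -> P (fun_of f).
Proof.
move=> cP FP; have := set_mem (valP f).
by move=> /(@closureS {ptws X -> R} _ _ FP); rewrite -(closure_id P).1.
Qed.

Lemma closed_ptws_le (x : X) (c : R) : closed ([set f | f x <= c] : set {ptws X -> R}).
Proof.
apply: (@closed_comp {ptws X -> R} R (fun f => f x) [set r | r <= c]).
  by move=> f _; exact: (@proj_continuous _ (fun=> R) x).
exact: closed_le.
Qed.

Lemma fun_of_sublinear : (forall f, F f -> sublinear f) ->
  forall f : ptws_closure F0, sublinear (fun_of f).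
Proof.
move=> Fs f.
have ev x : continuous ((fun g => g x) : {ptws X -> R} -> R).
  by move=> g; exact: (@proj_continuous _ (fun=> R) x).
split=> [x y|a x a0].
- pose h (g : {ptws X -> R}) : R := g (x + y) - (g x + g y).
  have ch : continuous h.
    by move=> g; exact: cvgB (ev (x + y) g) (cvgD (ev x g) (ev y g)).
  rewrite -subr_le0; apply: (@closure_closed_ptws (h @^-1` [set r | r <= 0]) f).
    apply: (@closed_comp {ptws X -> R} R h [set r | r <= 0]) => [g _|]; first exact: ch.
    exact: closed_le.
  by move=> g /Fs[gD _]; rewrite /= subr_le0.
- pose h (g : {ptws X -> R}) : R := g (a *: x) - a * g x.
  have ch : continuous h.
    by move=> g; exact: cvgB (ev (a *: x) g) (cvgM (cvg_cst a) (ev x g)).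
  apply/eqP; rewrite -subr_eq0; apply/eqP.
  apply: (@closure_closed_ptws (h @^-1` [set 0]) f).
    apply: (@closed_comp {ptws X -> R} R h [set 0]) => [g _|]; first exact: ch.
    exact: closed_eq.
  by move=> g /Fs[_ gZ]; rewrite /= /h gZ// subrr.
Qed.

Lemma fun_of_bounded : forall x, exists M, forall f : ptws_closure F0, `|fun_of f x| <= M.
Proof.
move=> x; have [M FM] := bF x; exists M => f; rewrite ler_norml; apply/andP; split.
- apply: (@closure_closed_ptws [set g | - M <= g x] f).
    apply: (@closed_comp {ptws X -> R} R (fun f => f x) [set r | - M <= r]).
      by move=> g _; exact: (@proj_continuous _ (fun=> R) x).
    exact: closed_ge.
  by move=> g /FM; rewrite ler_norml => /andP[].
- apply: (@closure_closed_ptws [set g | g x <= M] f); first exact: closed_ptws_le.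
  by move=> g /FM; rewrite ler_norml => /andP[].
Qed.

Lemma fun_of_le_sup (f : ptws_closure F0) x : fun_of f x <= sup [set f x | f in F].
Proof.
apply: (@closure_closed_ptws [set g | g x <= _] f); first exact: closed_ptws_le.
move=> g Fg /=; have [M FM] := bF x; apply: ub_le_sup; last by exists g.
by exists M => _ [h Fh <-]; apply: le_trans (FM h Fh); exact: ler_norm.
Qed.

(** Tychonoff: the closure is a closed subset of the product of the segments from [- M x] to
    [M x]. *)
Lemma ptws_closure_compact : compact [set: ptws_closure F0].
Proof.
apply: compact_set_type; have [M FM] := choice bF.
pose S := [set f : {ptws X -> R} | forall x : X, `[- M x, M x]%classic (f x)].
have cS : compact S.
  exact: (@tychonoff X (fun=> R) (fun x => `[- M x, M x]%classic)
            (fun x => @segment_compact _ _ _)).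
apply: (@subclosed_compact {ptws X -> R} _ S) => //; first exact: closed_closure.
have clS : closed S.
  by apply: compact_closed cS; apply: (@hausdorff_product X (fun=> R)) => x; exact: Rhausdorff.
rewrite (closure_id S).1//; apply: closureS => f Ff x.
by rewrite /= in_itv /= -ler_norml FM.
Qed.

Lemma ptws_closure_hausdorff : hausdorff_space (ptws_closure F0).
Proof.
apply: hausdorff_set_type; apply: (@hausdorff_product X (fun=> R)) => x.
exact: Rhausdorff.
Qed.

End ptws_closure.

(** * The dominating Radon probability *)

Lemma sup_rangeD_le {R : realType} (T : Type) (t0 : T) (g h : T -> R) : bounded_on g -> bounded_on h ->
  sup (range (fun t => g t + h t)) <= sup (range g) + sup (range h).
Proof.
move=> [M gM] [N hN].
apply: (sup_range_le t0) => t; apply: lerD.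
  by apply: (@sup_range_ge _ _ _ M) => s; apply: le_trans (gM s); exact: ler_norm.
by apply: (@sup_range_ge _ _ _ N) => s; apply: le_trans (hN s); exact: ler_norm.
Qed.

Lemma sup_rangeZ {R : realType} (T : Type) (t0 : T) (a : R) (g : T -> R) : 0 < a -> bounded_on g ->
  sup (range (fun t => a * g t)) = a * sup (range g).
Proof.
move=> a0 [M gM]; have {}gM t : g t <= M by apply: le_trans (gM t); exact: ler_norm.
apply/eqP; rewrite eq_le; apply/andP; split.
  by apply: (sup_range_le t0) => t; rewrite ler_pM2l//; exact: sup_range_ge gM.
rewrite -ler_pdivlMl//; apply: (sup_range_le t0) => t; rewrite ler_pdivlMl//.
by apply: (@sup_range_ge _ _ (fun t => a * g t) (a * M)) => s; rewrite ler_pM2l.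
Qed.

Section dominating_measure.
Context {R : realType} {X : lmodType R} {F : set (X -> R)} (F0 : F !=set0).
Hypotheses (bF : ptws_bounded F) (Fs : forall f, F f -> sublinear f).

Notation K := (ptws_closure F0).

Lemma dominating_radon (phi : {scalar X}) :
  (forall x, phi x <= sup [set f x | f in F]) ->
  exists2 P : probability (borel_type K) R, radon P &
    forall x, ((phi x)%:E <= \int[P]_(f in [set: borel_type K]) (fun_of (f : K) x)%:E)%E.
Proof.
move=> phiF.
pose q (h : K -> R^o) : R := sup (range h).
pose J (x : X) : K -> R^o := fun f => fun_of f x.
have bJ x : bounded_on (J x) by exact: fun_of_bounded.
have fs (f : K) := fun_of_sublinear Fs f.
have bD (g h : K -> R) : bounded_on g -> bounded_on h -> bounded_on (fun t => g t + h t).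
  by move=> bg bh; have := bounded_on_lin 1 bg bh; under eq_fun do rewrite mul1r.
have [|||||v x y bv|a x a0|x|L [LL Lq Lphi]] :=
    @hahn_banach_extension R (K -> R^o) (@bounded_on R K) _ _ X q J phi.
- exact: bounded_on_cst.
- by move=> a x y; exact: bounded_on_lin.
- by move=> x y; apply: sup_rangeD_le; exact: point.
- by move=> a x bx a0; apply: sup_rangeZ => //; exact: point.
- exact: bJ.
(* The points of [K] are only sublinear, so [J] need not be additive; the pointwise inequality
   [J (x + y) <= J x + J y] suffices under a supremum. *)
- have [M hM] := bD _ _ bv (bD _ _ (bJ x) (bJ y)).
  apply: (sup_range_le point) => f; apply: le_trans (sup_range_ge f _); last first.
    by move=> g; apply: le_trans (hM g); exact: ler_norm.
  by rewrite lerD2l; exact: (fs f).1.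
- by apply/funext => f; exact: (fs f).2.
(* Members of [F] are points of [K], so the supremum over [F] is at most that of [J x]. *)
- apply: le_trans (phiF x) _; apply: ge_sup.
    by have [f Ff] := F0; exists (f x), f.
  move=> _ [f Ff <-]; have [M hM] := bJ x.
  have cf : closure (F : set {ptws X -> R}) f by exact: (@subset_closure {ptws X -> R}).
  apply: (@sup_range_ge _ _ (J x) M (exist _ f (mem_set cf))) => g.
  by apply: le_trans (hM g); exact: ler_norm.
have [|P rP PL] := @radon_of_functional R K L (ptws_closure_compact bF)
    (@ptws_closure_hausdorff _ _ _ F0) LL.
  move=> f c bf fc; apply: le_trans (Lq f bf) _; exact: (sup_range_le point).
exists P => // x; apply: le_trans (PL (J x) _ (bJ x)); first by rewrite lee_fin.
exact: fun_of_continuous.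
Qed.

End dominating_measure.

(** * Disintegration *)

Section density_of_dominated_content.
Context {R : realType} d (T : measurableType d) (P : probability T R).
Variables (nu : set T -> R) (M : R).
Hypotheses (nuU : forall A B, measurable A -> measurable B -> A `&` B = set0 ->
    nu (A `|` B) = nu A + nu B)
  (nuM : forall A, measurable A -> `|nu A| <= M * fine (P A)).

Let nue (A : set T) : \bar R := (nu A)%:E.

Let nu0 : nu set0 = 0.
Proof.
have := @nuM set0 measurable0; rewrite measure0 mulr0 normr_le0.
by move=> /eqP.
Qed.

Let nue0 : nue set0 = 0%E. Proof. by rewrite /nue nu0. Qed.

Let nue_fin A : measurable A -> nue A \is a fin_num. Proof. by []. Qed.

(** Stated for an arbitrary [f] because it serves both [nu] and the real-valued [P]. *)
Let bigU (f : set T -> R) (F : nat -> set T) n : f set0 = 0 ->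
  (forall A B, measurable A -> measurable B -> A `&` B = set0 ->
    f (A `|` B) = f A + f B) ->
  (forall i, measurable (F i)) -> trivIset setT F ->
  f (\big[setU/set0]_(i < n) F i) = \sum_(i < n) f (F i).
Proof.
move=> f0 fU mF tF; elim: n => [|n ih]; first by rewrite !big_ord0.
rewrite !big_ord_recr/= fU ?ih//; first exact: bigsetU_measurable.
by apply: (@trivIset_bigsetUI _ predT) => //; rewrite /predT /= trueE.
Qed.

(** The remainder after [n] sets is bounded by [M] times its probability, which tends to [0] because
    [P] is countably additive. *)
Let nue_sigma_additive : semi_sigma_additive nue.
Proof.
move=> F mF tF mU; rewrite /nue.
under eq_fun do rewrite sumEFin big_mkord.
apply: cvg_EFin; first by apply: nearW => n.
rewrite /comp/=; set U := \bigcup_i F i.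
pose p A := fine (P A).
have PE A : measurable A -> P A = (p A)%:E by move=> mA; rewrite fineK// fin_num_measure.
have pF : (fun n => \sum_(i < n) p (F i)) @ \oo --> p U.
  have := @measure_semi_sigma_additive _ _ _ P F mF tF mU.
  rewrite -/U /= PE// => /fine_cvgP[_]; apply: cvg_trans; apply: near_eq_cvg.
  apply: nearW => n /=; rewrite big_mkord.
  rewrite (eq_bigr (fun i : 'I_n => (p (F i))%:E)) ?sumEFin// => i _; exact: PE.
have pM : (fun n => M * (p U - \sum_(i < n) p (F i))) @ \oo --> (0 : R).
  have := @cvgM _ _ (nbhs \oo) _ _ _ _ _ (@cvg_cst _ M _ _ _) (@cvgB _ _ _ (nbhs \oo) _ _ _ _ _ (@cvg_cst _ (p U) _ _ _) pF).
  by rewrite subrr mulr0; apply.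
have nuUF n : `|nu U - \sum_(i < n) nu (F i)| <= M * (p U - \sum_(i < n) p (F i)).
  pose V := \big[setU/set0]_(i < n) F i.
  have mV : measurable V by exact: bigsetU_measurable.
  have VU : V `<=` U by exact: bigsetU_bigcup.
  have mUV : measurable (U `\` V) by exact: measurableD.
  have -> : nu U - \sum_(i < n) nu (F i) = nu (U `\` V).
    rewrite -(bigU n nu0 nuU mF tF) -/V -[U in nu U](setDUK VU) nuU ?setDIK//.
    by rewrite addrC addKr.
  have -> : p U - \sum_(i < n) p (F i) = p (U `\` V).
    have pU A B : measurable A -> measurable B -> A `&` B = set0 ->
        p (A `|` B) = p A + p B.
      by move=> mA mB AB; rewrite /p measureU// fineD// fin_num_measure.
    have p0 : p set0 = 0 by rewrite /p measure0.
    by rewrite -(bigU n p0 pU mF tF) -/V -[U in p U](setDUK VU) pU ?setDIK// addrC addKr.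
  exact: nuM.
apply/subr_cvg0; apply/norm_cvg0P.
apply: (@squeeze_cvgr _ _ _ _ (fun=> 0) (fun n => M * (p U - \sum_(i < n) p (F i)))) => //.
  by apply: nearW => n; rewrite normr_ge0/= distrC nuUF.
exact: cvg_cst.
Qed.

HB.instance Definition _ := isCharge.Build _ _ _ nue nue0 nue_fin nue_sigma_additive.

(** Domination by [M] times [P] yields countable additivity as well as absolute continuity, so that
    Radon-Nikodym applies. *)
Lemma density_of_dominated_content : exists g : T -> R,
  P.-integrable setT (EFin \o g) /\
  forall A, measurable A -> nu A = Rintegral P A g.
Proof.
have dom : nue `<< P.
  apply/null_content_dominatesP => A mA PA0; rewrite /nue.
  by have := nuM mA; rewrite PA0 mulr0 normr_le0 => /eqP ->.
pose g := Radon_Nikodym nue P.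
have gfin x : g x \is a fin_num by exact: Radon_Nikodym_fin_num.
have gE : EFin \o (fine \o g) = g by apply/funext => x /=; rewrite fineK.
exists (fine \o g); rewrite gE; split; first exact: Radon_Nikodym_integrable.
move=> A mA; rewrite /Rintegral.
have -> : (fun x => ((fine \o g) x)%:E) = g by exact: gE.
by rewrite -Radon_Nikodym_integral.
Qed.

End density_of_dominated_content.

(** On measurable subsets of [N], where [h < g], the integrals of [g] and [h] coincide; hence
    [g = h] almost everywhere on [N], and [N] is null. *)
Lemma ae_le_of_Rintegral {R : realType} d (T : measurableType d)
    (P : probability T R) (g h : T -> R) :
  P.-integrable setT (EFin \o g) -> P.-integrable setT (EFin \o h) ->
  (forall A, measurable A -> Rintegral P A g <= Rintegral P A h) ->
  {ae P, forall t, g t <= h t}.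
Proof.
move=> ig ih gh.
have mg : measurable_fun setT g by exact/measurable_EFinP/(measurable_int P).
have mh : measurable_fun setT h by exact/measurable_EFinP/(measurable_int P).
pose N := [set t | h t < g t].
have mN : measurable N by rewrite -[N]setTI; exact: measurable_fun_ltr.
suff : ae_eq P N (EFin \o g) (EFin \o h).
  apply: filterS => t /= gh'; rewrite leNgt; apply/negP => Nt.
  by move: (gh' Nt) (Nt) => [->]; rewrite ltxx.
apply: integral_ae_eq => //.
- exact: integrableS ig.
- by apply/measurable_EFinP; exact: measurable_funTS.
move=> E EN mE.
have iE (f : T -> R) : P.-integrable setT (EFin \o f) -> P.-integrable E (EFin \o f).
  exact: integrableS.
have : Rintegral P E g = Rintegral P E h.
  apply/eqP; rewrite eq_le gh//=; apply: le_Rintegral => //; [exact: iE|exact: iE|].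
  by move=> t /EN/ltW.
rewrite /Rintegral => /(congr1 (@EFin R)).
by rewrite !fineK//; apply: integrable_fin_num => //; exact: iE.
Qed.

(** * Step functions and Strassen's disintegration *)

Section step_functions.
Context d (T : measurableType d) {X : zmodType}.

Definition step (A : set T) (x : X) : T -> X := fun t => if t \in A then x else 0.

(** The sets [A] may overlap, so that linear combinations require no common refinement. *)
Inductive is_step_sum : set (T -> X) :=
| is_step_sum0 : is_step_sum (fun=> 0)
| is_step_sumD A x u : measurable A -> is_step_sum u ->
    is_step_sum (fun t => step A x t + u t).

Lemma is_step_sum_step A x : measurable A -> is_step_sum (step A x).
Proof.
move=> mA; rewrite (_ : step A x = fun t => step A x t + 0).
  by apply: is_step_sumD mA is_step_sum0.
by apply/funext => t; rewrite addr0.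
Qed.

End step_functions.

Section step_functions_lmod.
Context {R : realType} d (T : measurableType d) {X : lmodType R}.

Lemma is_step_sum_lin (a : R) (u v : T -> X) : is_step_sum u -> is_step_sum v ->
  is_step_sum (a *: u + v).
Proof.
move=> + vs; elim=> [|A x {}u mA _ ih].
  rewrite (_ : _ + v = v)//; apply/funext => t.
  by rewrite -[(_ + _) t]/(a *: 0 + v t) scaler0 add0r.
rewrite (_ : _ + v = fun t => step A (a *: x) t + (a *: u + v) t).
  exact: is_step_sumD.
apply/funext => t; rewrite -[LHS]/(a *: (step A x t + u t) + v t).
rewrite -[(a *: u + v) t]/(a *: u t + v t) scalerDr addrA /step.
by case: ifP; rewrite ?scaler0.
Qed.

(** As [S] is not additive in its first argument, the induction carries a shift [x0]: removing a
    step on [A] leaves the shift [x0 + x] on [A] and [x0] off [A]. *)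
Lemma is_step_sum_comp (S : X -> T -> R) u :
  (forall x, measurable_fun setT (S x)) -> (forall x, bounded_on (S x)) ->
  is_step_sum u ->
  measurable_fun setT (fun t => S (u t) t) /\ bounded_on (fun t => S (u t) t).
Proof.
move=> mS bS su; suff H x0 : measurable_fun setT (fun t => S (x0 + u t) t) /\
    bounded_on (fun t => S (x0 + u t) t).
  by have := H 0; under eq_fun do rewrite add0r.
elim: su x0 => [|A x {}u mA _ ih] x0; first by under eq_fun do rewrite addr0.
have -> : (fun t => S (x0 + (step A x t + u t)) t) = fun t =>
    \1_A t * S (x0 + x + u t) t + (\1_(~` A) t * S (x0 + u t) t).
  apply/funext => t; rewrite !indicE in_setC /step.
  by case: ifP => _; rewrite ?mul1r ?mul0r ?addr0 ?add0r ?addrA.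
have [m1 [M b1]] := ih (x0 + x); have [m2 [N b2]] := ih x0; split.
  by apply: measurable_funD; apply: measurable_funM => //; apply: measurable_indic => //; exact: measurableC.
exists (M + N) => t; rewrite (le_trans (ler_normD _ _))// !indicE in_setC !normrM.
have := b1 t; have := b2 t; have := normr_ge0 (S (x0 + x + u t) t); have := normr_ge0 (S (x0 + u t) t).
by case: (t \in A) => /=; rewrite normr1 normr0; lra.
Qed.

End step_functions_lmod.

Section strassen.
Context {R : realType} d (T : measurableType d) (P : probability T R) {X : lmodType R}.
Variables (S : X -> T -> R) (phi : {scalar X}).
Hypotheses (Ssub : forall t, sublinear (S ^~ t))
  (mS : forall x, measurable_fun setT (S x)) (bS : forall x, bounded_on (S x))
  (phiS : forall x, phi x <= Rintegral P setT (S x)).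

Let steps : set (T -> X) := is_step_sum (X := X).

Let SD x y t : S (x + y) t <= S x t + S y t. Proof. exact: (Ssub t).1. Qed.
Let SZ a x t : 0 < a -> S (a *: x) t = a * S x t. Proof. exact: (Ssub t).2. Qed.
Let S0 t : S 0 t = 0.
Proof. exact: nat_sublinear0 (sublinear_nat_sublinear (Ssub t)). Qed.

Let iS u A : steps u -> measurable A ->
  P.-integrable A (EFin \o (fun t => S (u t) t)).
Proof.
move=> su mA; have [mSu bSu] := is_step_sum_comp mS bS su.
exact: bounded_on_integrable.
Qed.

Let is_cst x : steps (fun _ : T => x).
Proof.
rewrite (_ : (fun=> x) = step setT x); first exact: is_step_sum_step.
by apply/funext => t; rewrite /step in_setT.
Qed.

(** [J] sends a vector to a constant function. It is linear, so the inequality [phi x <= L (J x)],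
    applied also to [- x], becomes an equality. *)
Let extension : exists L : (T -> X) -> R,
  [/\ forall a u v, steps u -> steps v -> L (a *: u + v) = a * L u + L v,
      forall u, steps u -> L u <= Rintegral P setT (fun t => S (u t) t) &
      forall x, L (fun=> x) = phi x].
Proof.
pose q (u : T -> X) := Rintegral P setT (fun t => S (u t) t).
pose J (x : X) : T -> X := fun=> x.
have [|||||v x y sv|a x a0||L [LL Lq Lphi]] :=
    @hahn_banach_extension R (T -> X) steps _ _ X q J phi.
- exact: is_step_sum0.
- exact: is_step_sum_lin.
- move=> u v su sv; rewrite /q -RintegralD//; [|exact: iS..].
  have suv : steps (u + v) by have := is_step_sum_lin 1 su sv; rewrite scale1r.
  apply: le_Rintegral => //; [exact: iS suv _| |by move=> t _; exact: SD].
  by have := integrableD measurableT (iS su measurableT) (iS sv measurableT).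
- move=> a u su a0; rewrite /q -RintegralZl//; last exact: iS.
  by apply: eq_Rintegral => t _; rewrite -SZ.
- exact: is_cst.
- exact: lexx.
- by [].
- exact: phiS.
exists L; split=> // x; apply/eqP; rewrite eq_le Lphi andbT.
have L0 : L (fun=> 0) = 0.
  have := LL 1 _ _ (is_cst 0) (is_cst 0).
  rewrite (_ : 1 *: _ + _ = fun=> 0); first lra.
  by apply/funext => t; rewrite -[LHS]/(1 *: 0 + 0) scaler0 addr0.
have := LL (-1) _ _ (is_cst x) (is_cst 0).
rewrite (_ : _ + _ = J (- x)); last first.
  by apply/funext => t; rewrite -[LHS]/(-1 *: x + 0) scaleN1r addr0.
by have := Lphi (- x); rewrite raddfN L0; lra.
Qed.

(** For each [x] the content [nu x] has a density [g x]. Inequalities and identities between the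
    contents on all measurable sets pass to the densities almost everywhere, with a null set that
    depends on the vectors and scalars involved. *)
Lemma strassen : exists Y : X -> T -> R,
  [/\ forall x, measurable_fun setT (Y x),
      forall x t, Y x t <= S x t,
      forall a b y z, {ae P, forall t, Y (a *: y + b *: z) t = a * Y y t + b * Y z t} &
      forall x, ((phi x)%:E = \int[P]_t (Y x t)%:E)%E].
Proof.
have [L [LL Lq LE]] := extension.
have s_step A x : measurable A -> steps (step A x) by exact: is_step_sum_step.
have L0 : L (fun=> 0) = 0 by rewrite LE raddf0.
have LD u v : steps u -> steps v -> L (u + v) = L u + L v.
  by move=> su sv; have := LL 1 _ _ su sv; rewrite scale1r mul1r.
have LZ a u : steps u -> L (a *: u) = a * L u.
  by move=> su; have := LL a _ _ su (is_cst 0); rewrite L0 !addr0.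
pose nu x A := L (step A x).
have stepZ a x A : step A (a *: x) = a *: step A x.
  by apply/funext => t; rewrite -[RHS]/(a *: step A x t) /step; case: ifP; rewrite ?scaler0.
have nu_lin a b y z A : measurable A -> nu (a *: y + b *: z) A = a * nu y A + b * nu z A.
  move=> mA; rewrite /nu (_ : step A _ = a *: step A y + b *: step A z).
    have sz : steps (b *: step A z) by rewrite -stepZ; exact: s_step.
    by rewrite (LL _ _ _ (s_step A y mA) sz) (LZ _ _ (s_step A z mA)).
  apply/funext => t; rewrite -[RHS]/(a *: step A y t + b *: step A z t) /step.
  by case: ifP; rewrite ?scaler0 ?addr0.
have nu_le x A : measurable A -> nu x A <= Rintegral P A (S x).
  move=> mA; apply: le_trans (Lq _ (s_step A x mA)) _.
  rewrite [leRHS]Rintegral_mkcond le_eqVlt; apply/orP; left; apply/eqP.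
  apply: eq_Rintegral => t _; rewrite /step patchE.
  by case: ifP => _; rewrite ?S0.
have iSx x A : measurable A -> P.-integrable A (EFin \o S x).
  by move=> mA; exact: bounded_on_integrable (mS x) (bS x).
have nuU x A B : measurable A -> measurable B -> A `&` B = set0 ->
    nu x (A `|` B) = nu x A + nu x B.
  move=> mA mB AB; rewrite /nu -LD; [|exact: s_step..].
  congr L; apply/funext => t; rewrite -[RHS]/(step A x t + step B x t) /step in_setU.
  case: (boolP (t \in A)) => tA; last by rewrite add0r.
  case: (boolP (t \in B)) => tB; last by rewrite addr0.
  have : (A `&` B) t by split; exact: set_mem.
  by rewrite AB.
(* The upper bound comes from [S x]; the lower one from [S (- x)], since [nu (- x) A = - nu x A]. *)
have nu_abs x : exists M, forall A, measurable A -> `|nu x A| <= M * fine (P A).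
  have [M1 SM1] := bS x; have [M2 SM2] := bS (- x); exists (`|M1| + `|M2|) => A mA.
  have le_cst y M : (forall t, `|S y t| <= M) -> nu y A <= `|M| * fine (P A).
    move=> SM; apply: le_trans (nu_le y A mA) _.
    rewrite -Rintegral_cst//; apply: le_Rintegral => //; first exact: iSx.
      by apply: bounded_on_integrable => //; exact: bounded_on_cst.
    move=> t _; apply: le_trans (ler_norm _) _; apply: le_trans (SM t) _; exact: ler_norm.
  have PA0 : 0 <= fine (P A) by apply: fine_ge0.
  have := le_cst _ _ SM1; have := le_cst _ _ SM2.
  have := nu_lin (-1) 0 x 0 A mA; rewrite scaleN1r scaler0 addr0 mul0r addr0 mulN1r => ->.
  have := normr_ge0 M1; have := normr_ge0 M2.
  by rewrite ler_norml; nra.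
have /choice[g gP] : forall x, exists g : T -> R, P.-integrable setT (EFin \o g) /\
    forall A, measurable A -> nu x A = Rintegral P A g.
  move=> x; have [M nuM] := nu_abs x.
  exact: density_of_dominated_content (nuU x) nuM.
have ig x : P.-integrable setT (EFin \o g x) by have [] := gP x.
have nuE x A : measurable A -> nu x A = Rintegral P A (g x) by have [_] := gP x; apply.
have mg x : measurable_fun setT (g x) by exact/measurable_EFinP/(measurable_int P).
have gS x : {ae P, forall t, g x t <= S x t}.
  apply: ae_le_of_Rintegral => //; first exact: iSx.
  by move=> A mA; rewrite -nuE// nu_le.
(* Truncation changes [g x] on a null set only, and makes the domination by [S x] hold
   everywhere. *)
pose Y x t := Num.min (g x t) (S x t).
have gY x : {ae P, forall t, g x t = Y x t}.
  by apply: filterS (gS x) => t gSt; rewrite /Y min_l.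
have mY x : measurable_fun setT (Y x) by exact: measurable_minr.
exists Y; split=> //.
- by move=> x t; rewrite /Y ge_min lexx orbT.
- move=> a b y z.
  have glin : {ae P, forall t, g (a *: y + b *: z) t = a * g y t + b * g z t}.
    pose h t := a * g y t + b * g z t.
    have iZ c x : P.-integrable setT (EFin \o (fun t => c * g x t)).
      by have := integrableZl measurableT c (ig x).
    have ih : P.-integrable setT (EFin \o h).
      by have := integrableD measurableT (iZ a y) (iZ b z).
    have hE (A : set T) : measurable A -> Rintegral P A (g (a *: y + b *: z)) = Rintegral P A h.
      move=> mA; have iA (f : T -> R) : P.-integrable setT (EFin \o f) ->
        P.-integrable A (EFin \o f) by exact: integrableS.
      rewrite -nuE// nu_lin// RintegralD//; [|exact/iA/iZ..].
      by rewrite !RintegralZl//; [rewrite -!nuE|exact/iA/ig..].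
    have le1 : {ae P, forall t, g (a *: y + b *: z) t <= h t}.
      by apply: ae_le_of_Rintegral => // A mA; rewrite hE.
    have le2 : {ae P, forall t, h t <= g (a *: y + b *: z) t}.
      by apply: ae_le_of_Rintegral => // A mA; rewrite hE.
    by apply: filterS2 le1 le2 => t le1 le2; apply/eqP; rewrite eq_le le1.
  apply: filterS2 (filterI glin (gY (a *: y + b *: z))) (filterI (gY y) (gY z)).
  by move=> t [gl <-] [<- <-].
- move=> x; transitivity (\int[P]_t (g x t)%:E)%E.
    rewrite -[RHS]fineK; last exact: integrable_fin_num (ig x).
    have := nuE x setT measurableT; rewrite /Rintegral => <-.
    rewrite -LE; by congr (L _)%:E; apply/funext => t; rewrite /step in_setT.
  apply: ae_eq_integral => //; [exact/measurable_EFinP|exact/measurable_EFinP|].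
  by apply: filterS (gY x) => t ->.
Qed.

End strassen.

(** * Separable spaces *)

Lemma measurable_inf_range {R : realType} d (T : measurableType d)
    (h : nat -> T -> R) (c : T -> R) : (forall n t, c t <= h n t) ->
  (forall n, measurable_fun setT (h n)) ->
  measurable_fun setT (fun t => inf (range (fun n => h n t))).
Proof.
move=> ch mh; have := @measurable_fun_infs _ _ R setT h 0.
rewrite (_ : (fun x => infs (h ^~ x) 0) = fun t => inf (range (fun n => h n t))).
  by apply=> // t _; exists (c t) => _ [n _ <-].
by apply/funext => t; congr inf; apply/seteqP; split=> _ [n _ <-]; exists n.
Qed.

(** The subgroup generated by a countable dense set, enumerated through codes of signed words:
    concatenation gives sums, and flipping all signs gives opposites. *)
Lemma separable_subgroup {R : realType} {X : topologicalLmodType R} :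
  separable X -> exists y : nat -> X,
    [/\ dense (range y), forall i j, exists k, y k = y i + y j &
        forall i, exists k, y k = - y i].
Proof.
move=> [D [/countable_injP[f finj] dD]].
(* The element of [D] with number [n], or [0] if there is none. *)
pose e n : X := xget 0 [set x | D x /\ f x = n].
pose w (s : seq (bool * nat)) : X := \sum_(c <- s) (if c.1 then e c.2 else - e c.2).
pose u n : seq (bool * nat) := odflt [::] (unpickle n).
pose y n : X := w (u n).
have yw (s : seq (bool * nat)) : y (pickle s) = w s by rewrite /y /u pickleK.
exists y; split.
- move=> U U0 oU; have [x [Ux Dx]] := dD U U0 oU.
  exists x; split=> //; exists (pickle [:: (true, f x)]) => //.
  rewrite yw /w big_seq1 /= /e; case: xgetP => [z _ [Dz fz]|/(_ x)]; last by case.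
  by apply: finj; rewrite ?inE.
- move=> i j; exists (pickle (u i ++ u j)).
  by rewrite yw /w big_cat.
- move=> i; exists (pickle [seq (~~ c.1, c.2) | c <- u i]).
  rewrite yw /w big_map -sumrN; apply: eq_bigr => -[[] n] _ //=.
  by rewrite opprK.
Qed.

(** For [z] in the dense range, [p x + p (- x)] is at most [p z + p (- z) + f (x - z) + f (z - x)],
    and the last two terms are small for [z] near [x] since [f] is continuous with [f 0 = 0]. *)
Lemma dense_subadditive_linear {R : realType} {X : topologicalLmodType R}
    (p f : X -> R) (y : nat -> X) :
  (forall x z, p (x + z) <= p x + p z) -> (forall x, p x <= f x) ->
  sublinear f -> continuous f -> dense (range y) ->
  (forall n, p (y n) + p (- y n) <= 0) ->
  forall a x z, p (a *: x + z) = a * p x + p z.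
Proof.
move=> pD pf fs cf dy py; apply: (additive_dominated_linear pD _ fs pf) => x.
apply/ler_addgt0Pr => e e0; rewrite add0r.
have f0 : f 0 = 0 := nat_sublinear0 (sublinear_nat_sublinear fs).
have cfg (g : X -> X) : continuous g -> g x = 0 ->
    open [set z | f (g z) < e / 2] /\ f (g x) < e / 2.
  move=> cg gx; split; last by rewrite gx f0; lra.
  apply: (@open_comp X R (f \o g) [set r | r < e / 2]); last exact: open_lt.
  by move=> z _; apply: continuous_comp; [exact: cg|exact: cf].
have c1 : continuous (fun z : X => x - z).
  move=> z; apply: (@continuous_comp X (X * X)%type X (fun z => (x, z)) (fun z => z.1 - z.2)).
    by apply: cvg_pair => /=; [exact: cvg_cst|exact: cvg_id].
  exact: sub_continuous.
have c2 : continuous (fun z : X => z - x).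
  move=> z; apply: (@continuous_comp X (X * X)%type X (fun z => (z, x)) (fun z => z.1 - z.2)).
    by apply: cvg_pair => /=; [exact: cvg_id|exact: cvg_cst].
  exact: sub_continuous.
have [U1 x1] := cfg _ c1 (subrr x); have [U2 x2] := cfg _ c2 (subrr x).
have [|z [[/= z1 z2] [n _ ynz]]] := dy _ _ (openI U1 U2); first by exists x.
move: z1 z2; rewrite -{z}ynz => z1 z2.
have := pD (y n) (x - y n); have := pD (- y n) (y n - x).
rewrite [y n + (x - y n)]addrC subrK addKr => E1 E2.
by have := py n; have := pf (x - y n); have := pf (y n - x); lra.
Qed.

Section extremal_minorant.
Context {R : realType} {V : zmodType} (f : V -> R) (y : nat -> V).
Hypothesis fs : nat_sublinear f.

(** An explicit substitute for the choice of a minimal minorant: step [m] enforces oddness at [y m],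
    and only countable infima are used, so the result depends measurably on [f]. *)
Fixpoint lower_iter n : V -> R :=
  if n is m.+1 then lower (lower_iter m) (y m) else f.

Definition lower_lim x : R := inf (range (lower_iter ^~ x)).

Let lower_iter_nat_sublinear n : nat_sublinear (lower_iter n).
Proof. by elim: n => //= n ih; exact: lower_nat_sublinear. Qed.

Let lower_iter_le n m x : (n <= m)%N -> lower_iter m x <= lower_iter n x.
Proof.
elim: m => [|m ih]; first by rewrite leqn0 => /eqP ->.
rewrite leq_eqVlt => /predU1P[->//|/ih]; apply: le_trans.
exact: lower_le.
Qed.

Lemma lower_iter_ge n x : - f (- x) <= lower_iter n x.
Proof.
apply: le_trans (nat_sublinear_opp x (lower_iter_nat_sublinear n)).
by rewrite lerN2 (@lower_iter_le 0 n _ (leq0n n)).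
Qed.

(** The bound involves [f] alone, uniformly in [n] and [k]; it supplies the minorant in the proof
    that the iterates are measurable. *)
Lemma lower_iterS_lbound n x k :
  - f (- x) <= lower_iter n (x + y n *+ k) - lower_iter n (y n) *+ k.
Proof.
apply: le_trans (lower_lbound (y n) (lower_iter_nat_sublinear n) x k).
by rewrite lerN2 (@lower_iter_le 0 n _ (leq0n n)).
Qed.

Let lower_lim_iter n x : lower_lim x <= lower_iter n x.
Proof. exact: inf_range_le (fun n => lower_iter_ge n x). Qed.

Lemma lower_lim_le x : lower_lim x <= f x.
Proof. exact: lower_lim_iter 0%N x. Qed.

(** The iterates decrease, so the later of two indices serves both summands. *)
Lemma lower_limD x z : lower_lim (x + z) <= lower_lim x + lower_lim z.
Proof.
apply: (le_inf_rangeD 0%N 0%N) => i j.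
apply: le_trans (lower_lim_iter (maxn i j) _) _.
apply: le_trans ((lower_iter_nat_sublinear _).1 _ _) _.
by apply: lerD; apply: lower_iter_le; rewrite ?leq_maxl ?leq_maxr.
Qed.

(** Compare [y n] at stage [n] with [- y n] at stage [n.+1], where [lower_opp] applies. *)
Lemma lower_lim_opp n : lower_lim (y n) + lower_lim (- y n) <= 0.
Proof.
have := lower_opp (y n) (lower_iter_nat_sublinear n).
have := lower_lim_iter n (y n); have := lower_lim_iter n.+1 (- y n) => /=; lra.
Qed.

End extremal_minorant.

Section separable_selection.
Context {R : realType} {X : topologicalLmodType R} d (T : measurableType d)
  (P : probability T R) (S Y : X -> T -> R).
Hypotheses (sX : separable X) (Ssub : forall t, sublinear (S ^~ t))
  (cS : forall t, continuous (S ^~ t)) (mS : forall x, measurable_fun setT (S x))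
  (mY : forall x, measurable_fun setT (Y x)) (YS : forall x t, Y x t <= S x t)
  (Ylin : forall a b y z,
    {ae P, forall t, Y (a *: y + b *: z) t = a * Y y t + b * Y z t}).

Let Ssubn t : nat_sublinear (S ^~ t) := sublinear_nat_sublinear (Ssub t).

(** Off a null set [N], [Y] is additive and odd on the dense subgroup, and [Q] is the largest
    extension compatible with subadditivity and the majorant [S]; [dense_subadditive_linear] makes
    it linear. On [N], [lower_lim] is linear for the same reason. *)
Lemma separable_selection : exists Z : X -> T -> R,
  [/\ forall x, measurable_fun setT (Z x), forall x t, Z x t <= S x t,
      forall t a x z, Z (a *: x + z) t = a * Z x t + Z z t &
      forall x, (\int[P]_t (Z x t)%:E = \int[P]_t (Y x t)%:E)%E].
Proof.
have [y [dy yD yN]] := separable_subgroup sX.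
have YD x z : {ae P, forall t, Y (x + z) t = Y x t + Y z t}.
  by apply: filterS (Ylin 1 1 x z) => t; rewrite !scale1r !mul1r.
have YN x : {ae P, forall t, Y (- x) t = - Y x t}.
  apply: filterS (Ylin (-1) 0 x 0) => t.
  by rewrite scaleN1r scaler0 addr0 mulN1r mul0r addr0.
(* Only countably many relations are imposed, so one null set covers all exceptions. *)
have [N [mN PN0 Nsub]] : {ae P, forall t,
    (forall i j, Y (y i + y j) t = Y (y i) t + Y (y j) t) /\
    (forall i, Y (- y i) t = - Y (y i) t)}.
  apply: filterI; last by apply: ae_foralln => i; exact: YN.
  by apply: ae_foralln => i; apply: ae_foralln => j; exact: YD.
have goodD t i j : ~ N t -> Y (y i + y j) t = Y (y i) t + Y (y j) t.
  by move=> Nt; apply: contrapT => H; apply: Nt; apply: Nsub => -[/(_ i j)].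
have goodN t i : ~ N t -> Y (- y i) t = - Y (y i) t.
  by move=> Nt; apply: contrapT => H; apply: Nt; apply: Nsub => -[_ /(_ i)].
(* The maximum bounds the infimum from below also on [N]. *)
pose Q x t := inf (range (fun n => Num.max (Y (y n) t + S (x - y n) t) (- S (- x) t))).
have Q_lb x t n : - S (- x) t <= Num.max (Y (y n) t + S (x - y n) t) (- S (- x) t).
  by rewrite le_max lexx orbT.
have mQ x : measurable_fun setT (Q x).
  apply: (measurable_inf_range (c := fun t => - S (- x) t)) => [n t|n]; first exact: Q_lb.
  by apply: measurable_maxr; [exact: measurable_funD|exact: measurableT_comp].
(* Off [N] the maximum changes nothing: [- Y (y n) t] equals [Y (- y n) t], which is at most
   [S (- y n) t] and hence at most [S (x - y n) t + S (- x) t]. *)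
have Qle t x n : ~ N t -> Q x t <= Y (y n) t + S (x - y n) t.
  move=> Nt; apply: le_trans (inf_range_le n (Q_lb x t)) _.
  rewrite ge_max lexx /=; have := (Ssub t).1 (x - y n) (- x).
  rewrite addrAC subrr add0r; have := YS (- y n) t; rewrite goodN//; lra.
have QD t x z : ~ N t -> Q (x + z) t <= Q x t + Q z t.
  move=> Nt; apply: (le_inf_rangeD 0%N 0%N) => i j; have [k yk] := yD i j.
  apply: le_trans (Qle _ _ k Nt) _; rewrite yk goodD//.
  have := (Ssub t).1 (x - y i) (z - y j); rewrite addrACA -opprD.
  have := Q_lb x t i.
  have : forall a b : R, a <= Num.max a b by move=> a b; rewrite le_max lexx.
  move=> mx; have := mx (Y (y i) t + S (x - y i) t) (- S (- x) t).
  have := mx (Y (y j) t + S (z - y j) t) (- S (- z) t); lra.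
have y0 : exists k, y k = 0.
  by have [k yk] := yN 0%N; have [l yl] := yD 0%N k; exists l; rewrite yl yk subrr.
have Y0 t : ~ N t -> Y 0 t = 0.
  move=> Nt; have [k yk] := y0; have := goodN t k Nt; rewrite yk oppr0; lra.
have QS t x : ~ N t -> Q x t <= S x t.
  move=> Nt; have [k yk] := y0; have := Qle t x k Nt.
  by rewrite yk subr0 Y0// add0r.
have S0 t : S 0 t = 0 := nat_sublinear0 (Ssubn t).
have Qy t n : ~ N t -> Q (y n) t + Q (- y n) t <= 0.
  move=> Nt; have [k yk] := yN n; have := Qle t (y n) n Nt; have := Qle t (- y n) k Nt.
  by rewrite yk !subrr S0 goodN//; lra.
have Qlin t : ~ N t -> forall a x z, Q (a *: x + z) t = a * Q x t + Q z t.
  move=> Nt; apply: (@dense_subadditive_linear R X (Q ^~ t) (S ^~ t) y) => // [x z|x|n].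
  - exact: QD.
  - exact: QS.
  - exact: Qy.
pose W x t := lower_lim (S ^~ t) y x.
have Wlin t a x z : W (a *: x + z) t = a * W x t + W z t.
  apply: (@dense_subadditive_linear R X (W ^~ t) (S ^~ t) y) => // [x' z'|x'|n].
  - exact: lower_limD (Ssubn t) _ _.
  - exact: lower_lim_le (Ssubn t) _.
  - exact: lower_lim_opp (Ssubn t) _.
have miter n x : measurable_fun setT (fun t => lower_iter (S ^~ t) y n x).
  elim: n x => [|n ih] x; first exact: mS.
  apply: (measurable_inf_range (c := fun t => - S (- x) t)) => [k t|k].
    exact: lower_iterS_lbound.
  apply: measurable_funB; first exact: ih.
  by under eq_fun do rewrite -mulr_natl; exact: measurable_funM.
have mW x : measurable_fun setT (W x).
  apply: (measurable_inf_range (c := fun t => - S (- x) t)) => [k t|k]; last exact: miter.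
  exact: lower_iter_ge.
pose Z x t := \1_N t * W x t + \1_(~` N) t * Q x t.
have ZW x t : N t -> Z x t = W x t.
  by move=> Nt; rewrite /Z !indicE in_setC mem_set//= mul1r mul0r addr0.
have ZQ x t : ~ N t -> Z x t = Q x t.
  by move=> Nt; rewrite /Z !indicE in_setC memNset//= mul1r mul0r add0r.
have mZ x : measurable_fun setT (Z x).
  apply: measurable_funD; apply: measurable_funM => //.
  by apply: measurable_indic => //; exact: measurableC.
exists Z; split=> //.
- move=> x t; have [Nt|Nt] := pselect (N t); first by rewrite ZW//; exact: lower_lim_le (Ssubn t) _.
  by rewrite ZQ// QS.
- move=> t a x z; have [Nt|Nt] := pselect (N t); first by rewrite !ZW// Wlin.
  by rewrite !ZQ// Qlin.
move=> x; apply: ae_eq_integral => //; [exact/measurable_EFinP|exact/measurable_EFinP|].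
(* For each [n], almost surely [Y z] splits as [Y (y n) + Y (z - y n)], and the last term is at most
   [S (z - y n)]. Applied to [x] and [- x], at both of which [Y] and [Q] are odd, this gives
   [Y x = Q x] almost everywhere. *)
have YQ z : {ae P, forall t, ~ N t -> Y z t <= Q z t}.
  have : {ae P, forall t, forall n, Y z t = Y (y n) t + Y (z - y n) t}.
    apply: ae_foralln => n; apply: filterS (YD (y n) (z - y n)) => t.
    by rewrite addrC subrK.
  apply: filterS => t H Nt; apply: (le_inf_range 0%N) => n; rewrite le_max.
  by rewrite (H n) lerD2l YS.
have Nae : {ae P, forall t, ~ N t} by exists N; split=> // t /contrapT.
apply: filterS2 (filterI (YQ x) (YQ (- x))) (filterI (YN x) Nae).
move=> t [YQx YQNx] [YNx Nt] _ /=; congr EFin; rewrite ZQ//.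
have Q0 : Q 0 t = 0 by have := Qlin t Nt 1 0 0; rewrite scale1r addr0; lra.
have := Qlin t Nt (-1) x 0; rewrite scaleN1r addr0 Q0.
have := YQx Nt; have := YQNx Nt; rewrite YNx; lra.
Qed.

End separable_selection.

(** * The representation theorem *)

Lemma ae_borel_null {R : realType} {X : lmodType R} {F : set (X -> R)}
    {F0 : F !=set0} (P : probability (borel_type (ptws_closure F0)) R)
    (Q : ptws_closure F0 -> Prop) :
  {ae P, forall f, Q f} ->
  exists N, borel_null P N /\ forall f, ~ N f -> Q f.
Proof.
move=> [N [mN PN QN]]; exists N; split=> // f Nf.
by apply: contrapT => Qf; exact/Nf/QN.
Qed.

(** Integrability is deduced from the integral being a real number. Truncating at [c] keeps the
    integral and gives the upper bound everywhere. *)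
Lemma integral_le_of_ae_le {R : realType} d (T : measurableType d)
    (P : probability T R) (g : T -> R) (v c : R) :
  measurable_fun setT g -> v%:E = (\int[P]_t (g t)%:E)%E ->
  {ae P, forall t, g t <= c} -> v <= c.
Proof.
move=> mg vg gc.
pose g' t := Num.min (g t) c.
have mg' : measurable_fun setT g' by exact: measurable_minr.
have vg' : v%:E = (\int[P]_t (g' t)%:E)%E.
  rewrite vg; apply: ae_eq_integral => //; [exact/measurable_EFinP..|].
  by apply: filterS gc => t gt _ /=; rewrite /g' min_l.
have ig' : P.-integrable setT (EFin \o g').
  apply/integrableP; split; first exact/measurable_EFinP.
  apply/abse_integralP => //; first exact/measurable_EFinP.
  by rewrite -vg' ltry.
have -> : v = Rintegral P setT g' by rewrite /Rintegral -vg'.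
rewrite -[leRHS](Rintegral_probability_cst P).
apply: le_Rintegral => //; last by move=> t _; rewrite /g' ge_min lexx orbT.
by apply: bounded_on_integrable => //; exact: bounded_on_cst.
Qed.

Section representation.
Context {R : realType} {X : lmodType R} {F : set (X -> R)} (F0 : F !=set0).
Hypotheses (Fs : forall f, F f -> sublinear f) (bF : ptws_bounded F).
Variable phi : {scalar X}.

Notation K := (ptws_closure F0).
Notation B := (borel_type K).

Lemma fun_of_measurable x : measurable_fun [set: B] (fun f : B => fun_of (f : K) x).
Proof. exact: (@continuous_borel_measurable R K _ (@fun_of_continuous _ _ _ F0 x)). Qed.

(** Common source of both halves of the theorem: domination holds everywhere, linearity only up to
    null sets depending on the scalars and vectors. *)
Lemma exists_representation : (forall x, phi x <= sup [set f x | f in F]) ->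
  exists (P : probability B R) (Y : X -> K -> R),
  [/\ represents phi P Y, forall x f, Y x f <= fun_of f x &
      forall a b y z,
      {ae P, forall f, Y (a *: y + b *: z) f = a * Y y f + b * Y z f}].
Proof.
move=> phiF; have [P rP phiP] := dominating_radon F0 bF Fs phiF.
pose S (x : X) (f : B) : R := fun_of (f : K) x.
have bS x : bounded_on (S x) := fun_of_bounded F0 bF x.
have [||x|x|Y [mY YS Ylin Yint]] := @strassen R _ B P X S phi.
- by move=> f; exact: fun_of_sublinear.
- exact: fun_of_measurable.
- exact: bS.
- rewrite -lee_fin; apply: le_trans (phiP x) _; rewrite fineK//.
  apply: integrable_fin_num => //.
  exact: (bounded_on_integrable P measurableT (fun_of_measurable x) (bS x)).
by exists P, Y.
Qed.

End representation.
Theorem theorem6 (R : realType) :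
  (forall (X : lmodType R) (F : set (X -> R)) (F0 : F !=set0),
     (forall f, F f -> sublinear f) ->
     ptws_bounded F ->
     forall phi : {scalar X},
       (forall x : X, phi x <= sup [set f x | f in F]) <->
       exists (lambda : probability (borel_type (ptws_closure F0)) R)
              (T : X -> ptws_closure F0 -> R),
         represents phi lambda T /\
         forall (a b : R) (y z : X), exists N, borel_null lambda N /\
           forall (x : X) (f : ptws_closure F0), ~ N f ->
             dominated_linear T a b x y z f)
  /\
  (forall (X : topologicalLmodType R) (F : set (X -> R)) (F0 : F !=set0),
     (forall f, F f -> sublinear f) ->
     ptws_bounded F ->
     forall phi : {scalar X},
       (forall x : X, phi x <= sup [set f x | f in F]) ->
       separable X ->
       closed (F : set {ptws X -> R}) ->
       continuous (phi : X -> R) ->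
       (forall f, F f -> continuous (f : X -> R)) ->
       (exists (lambda : probability (borel_type (ptws_closure F0)) R)
               (T : X -> ptws_closure F0 -> R),
          represents phi lambda T /\
          exists N, borel_null lambda N /\
            forall f : ptws_closure F0, ~ N f ->
              forall (x y z : X) (a b : R), dominated_linear T a b x y z f)
       /\
       (F_space X ->
        exists (lambda : probability (borel_type (ptws_closure F0)) R)
               (T : X -> ptws_closure F0 -> R),
          represents phi lambda T /\
          forall f : ptws_closure F0, F (fun_of f) ->
            forall (x y z : X) (a b : R), dominated_linear T a b x y z f)).
Proof.
split=> [X F F0 Fs bF phi|X F F0 Fs bF phi phiF sX cF _ Fc].
  split=> [phiF|[P [T [rT HT]]]].
    have [P [Y [rY YS Ylin]]] := exists_representation F0 Fs bF phiF.
    exists P, Y; split=> // a b y z.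
    have [N [N0 NY]] := ae_borel_null (Ylin a b y z).
    by exists N; split=> // x f Nf; split; [exact: YS|exact: NY].
  move=> x; have [_ mT phiT] := rT.
  (* Any choice of scalars and vectors gives the domination off a null set, and points of the
     closure are still bounded by the supremum over [F]. *)
  have [N [[mN PN0] NT]] := HT 0 0 0 0.
  apply: integral_le_of_ae_le (mT x) (phiT x) _; exists N; split=> // f /= Tf.
  apply: contrapT => Nf; apply: Tf; have [Tf _] := NT x f Nf.
  by apply: le_trans Tf _; exact: fun_of_le_sup.
(* [F] is its own closure, so every point of the compact space is a continuous functional. *)
have Ff (f : ptws_closure F0) : F (fun_of f) by exact: closure_closed_ptws.
have [P [Y [[rP mY phiY] YS Ylin]]] := exists_representation F0 Fs bF phiF.
have [Z [mZ ZS Zlin ZY]] := @separable_selection R X _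
    (borel_type (ptws_closure F0)) P (fun x f => fun_of f x) Y sX
    (fun f => Fs _ (Ff f)) (fun f => Fc _ (Ff f)) (@fun_of_measurable _ _ _ F0) mY YS Ylin.
have rZ : represents phi P Z.
  by split=> // x; rewrite phiY ZY.
have Zdom f x y z a b : dominated_linear Z a b x y z f.
  split; first exact: ZS.
  have Z0 : Z 0 f = 0 by have := Zlin f 1 0 0; rewrite scale1r addr0; lra.
  have := Zlin f b z 0; rewrite addr0 Z0 addr0 => <-; exact: Zlin.
(* Domination and linearity of [Z] hold at every point, so the empty set serves as the exceptional
   null set. *)
split; first by exists P, Z; split=> //; exists set0; split.
by move=> _; exists P, Z.
Qed.
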